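(* Let $\mathbf{T}=(T_1,\dots,T_d)\in\mathfrak{B}(\mathcal{H})^d$. Then for any $t\in[0,1]$, $$\|\widetilde{\mathbf{T}}\|\le\|\widehat{\mathbf{T}}(t)\|\le\frac12\left(\|\mathbf{T}^D\|^t\|\mathbf{T}\|^{1-t}+\|\mathbf{T}^D\|^{1-t}\|\mathbf{T}\|^t\right)\le\|\mathbf{T}\|.$$ In particular, $\|\widetilde{\mathbf{T}}\|\le\|\widehat{\mathbf{T}}(t)\|\le\frac12(\|\mathbf{T}^D\|+\|\mathbf{T}\|)\le\|\mathbf{T}\|$.
   Context: $\mathcal{H}$ is a separable complex Hilbert space, $\mathfrak{B}(\mathcal{H})$ the bounded linear operators on $\mathcal{H}$, and $d\in\mathbb{N}$. The spherical (joint) operator norm of a tuple $\mathbf{T}=(T_1,\dots,T_d)\in\mathfrak{B}(\mathcal{H})^d$ is $\|\mathbf{T}\|=\sup\{(\sum_{k=1}^d\|T_kx\|^2)^{1/2}: x\in\mathcal{H},\ \|x\|=1\}$. Canonical spherical polar decomposition: $\mathbf{T}=\mathbf{V}P=(V_1P,\dots,V_dP)$, where $P=\sqrt{T_1^*T_1+\cdots+T_d^*T_d}$ and $\mathbf{V}=(V_1,\dots,V_d)$, viewed as a column operator $\mathcal{H}\to\mathcal{H}^d$, is the partial isometry with initial space $\mathcal{N}(P)^\perp$; that is, $T_i=V_iP$ for all $i$ and $\sum_{i=1}^dV_i^*V_i$ is the orthogonal projection onto $\mathcal{N}(P)^\perp=\overline{\mathcal{R}(P)}$. The conventions $P^0=I$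 and $a^0=1$ for real $a\ge0$ are used. For $t\in[0,1]$: the generalized spherical Aluthge transform is $\widetilde{\mathbf{T}}(t)=(P^tV_1P^{1-t},\dots,P^tV_dP^{1-t})$; the spherical Aluthge transform is $\widetilde{\mathbf{T}}=\widetilde{\mathbf{T}}(1/2)$; the spherical Duggal transform is $\mathbf{T}^D=(PV_1,\dots,PV_d)$; the spherical Heinz transform is $\widehat{\mathbf{T}}(t)=\frac12(\widetilde{\mathbf{T}}(t)+\widetilde{\mathbf{T}}(1-t))$ (coordinatewise operations). *)

(* Defs.v *)
From HB Require Import structures.
From mathcomp Require Import all_boot all_order all_algebra.
From mathcomp Require Import sesquilinear complex.
From mathcomp Require Import all_classical all_reals all_analysis.

Set Implicit Arguments.
Unset Strict Implicit.
Unset Printing Implicit Defensive.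
Import Order.TTheory GRing.Theory Num.Theory.
Import numFieldNormedType.Exports.
Local Open Scope classical_set_scope.
Local Open Scope ring_scope.
Local Open Scope complex_scope.

(* Complex Hilbert spaces; the inner product is linear in its first argument. *)
HB.mixin Record isHilbert (R : realType) H
    of CompleteNormedModule R[i] H := {
  inner : {dot H for @Num.conj R[i]};
  normr_inner : forall x : H, `|x| ^+ 2 = inner x x
}.

#[short(type="hilbertType")]
HB.structure Definition Hilbert (R : realType) :=
  {H of CompleteNormedModule R[i] H & isHilbert R H}.

Definition separable_space (X : topologicalType) : Prop :=
  exists2 D : set X, countable D & dense D.

Section Operators.
Context {R : realType} {H : hilbertType R}.
Implicit Types (A B : H -> H) (x y : H).

(* `|x| lives in R[i]; its imaginary part is 0. *)
Definition hnorm x : R := complex.Re `|x|.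

Definition bounded_operator A : Prop :=
  linear A /\ bounded_near A (nbhs (0 : H)).

Definition adjoint A y : H :=
  xget 0 [set z | forall x, inner (A x) y = inner x z].

Definition spectrum A : set R[i] :=
  [set l | ~ exists B, [/\ bounded_operator B,
             forall x, B (A x - l *: x) = x &
             forall x, A (B x) - l *: B x = x]].

Definition poly_op (p : {poly R}) A x : H :=
  \sum_(k < size p) (p`_k)%:C *: iter k A x.

(* Continuous functional calculus f(A) of a self-adjoint A: the limit in
   operator norm of p_n(A), where the polynomials p_n converge to f uniformly
   on the spectrum of A.  The norm convergence is spelled out because [sup] is 0
   on unbounded sets. *)
Definition is_cfc A (f : R -> R) B : Prop :=
  exists p : nat -> {poly R},
    {uniform [set a : R | spectrum A a%:C],
       (fun n => horner (p n)) @ \oo --> f} /\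
    forall e : R, 0 < e -> \forall n \near \oo,
      forall x, hnorm (poly_op (p n) A x - B x) <= e * hnorm x.

Definition cfc A (f : R -> R) : H -> H := xget (cst 0) (is_cfc A f).

Definition sqrt_op A : H -> H := cfc A Num.sqrt.

(* [powR] satisfies a `^ 0 = 1 for all a, including a = 0, so that P^0 = I. *)
Definition pow_op A (t : R) : H -> H := cfc A (fun a => a `^ t).

Definition orthocomp (M : set H) : set H :=
  [set y | forall x, M x -> inner x y = 0].

Definition is_orthoproj (M : set H) (E : H -> H) : Prop :=
  forall x, M (E x) /\ orthocomp M (x - E x).

Section Tuples.
Variable d : nat.
Implicit Types T V : 'I_d -> H -> H.

Definition tuple_norm T : R :=
  sup [set Num.sqrt (\sum_k hnorm (T k x) ^+ 2) | x in [set x | hnorm x = 1]].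

Definition gram T : H -> H := fun x => \sum_k adjoint (T k) (T k x).

Definition tuple_abs T : H -> H := sqrt_op (gram T).

Definition spherical_polar T V (P : H -> H) : Prop :=
  [/\ P = tuple_abs T,
      forall k, bounded_operator (V k),
      forall k, T k = V k \o P &
      is_orthoproj (orthocomp [set x | P x = 0]) (gram V)].

(* The transforms of T = VP, as functions of P and V. *)
Definition gen_aluthge (P : H -> H) V (t : R) : 'I_d -> H -> H :=
  fun k => pow_op P t \o V k \o pow_op P (1 - t).

Definition aluthge P V := gen_aluthge P V 2^-1.

Definition duggal (P : H -> H) V : 'I_d -> H -> H := fun k => P \o V k.

Definition heinz P V (t : R) : 'I_d -> H -> H :=
  fun k x => 2^-1 *: (gen_aluthge P V t k x + gen_aluthge P V (1 - t) k x).

End Tuples.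
End Operators.

(* Main.v *)
Require Import Defs.
From HB Require Import structures.
From mathcomp Require Import all_boot all_order all_algebra.
From mathcomp Require Import sesquilinear complex ring lra.
From mathcomp Require Import all_classical all_reals all_analysis.

Set Implicit Arguments.
Unset Strict Implicit.
Unset Printing Implicit Defensive.
Import Order.TTheory GRing.Theory Num.Theory.
Import numFieldNormedType.Exports.
Local Open Scope classical_set_scope.
Local Open Scope ring_scope.
Local Open Scope complex_scope.

(** Write [S] for a tuple and [|S|] for its joint norm, that is, the norm of
    the column operator [x |-> (S_1 x, ..., S_d x)], and put
    [A_t = (P^t V_k P^(1-t))_k].  Then [A_0 = T], [A_1] is the Duggal transform,
    [A_(1/2)] the Aluthge transform, and the Heinz transform is the mean
    [M = (A_t + A_(1-t)) / 2].

    Each of the two operator inequalities is proved at a vector [x] where the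
    column [S] nearly attains its norm [s].  At such a unit vector [S*S x] is
    close to [s^2 x] ([gram_approx_eigen]): a bounded operator has no eigenvectors
    in general, but these approximate ones replace them.  The vector tested is
    not [x] but [Q x], with [Q] a power of [P]; since [S] factors through [Q], the
    vector [Q x] stays away from [0], and the approximation error is negligible
    there too ([approx_singular_weighted]).

    - Lower bound.  By symmetry let [t >= 1/2], [S = A_(1/2)] and
      [Q = P^(t-1/2)].  From [P^t = Q P^(1/2)] and [P^(1/2) = P^(1-t) Q],
      [2 <M Q x, Q S x> = |Q S x|^2 + <S*S x, Q^2 x>], which is nearly
      [|Q S x|^2 + s^2 |Q x|^2].  The left side is at most
      [2 |M| |Q x| |Q S x| <= |Q S x|^2 + |M|^2 |Q x|^2], hence [s <= |M|]
      ([aluthge_le_heinz]).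
    - Upper bound.  With [c = (a+b)/2], [S = A_c], [Q = P^((a-b)/2)], moving
      powers of [P] across the inner product gives
      [<S*S x, Q^2 x> = <A_a Q x, A_b Q x>], so that [|A_c|^2 <= |A_a| |A_b|]
      ([gen_aluthge_midpoint]).  A bounded function that is midpoint log-convex
      on [[0,1]] lies below the geometric interpolation of its end values
      ([midpoint_interpolation]); hence
      [|A_t| <= |A_1|^t |A_0|^(1-t)], and the triangle inequality concludes.

    The remaining inequalities are between real numbers, given
    [|A_1| <= |A_0|]: the column [V] is a contraction because [V*V] is an
    orthogonal projection, and [|P| <= |T|] because [P^2 = T*T].

    All this rests on the calculus of powers of a positive operator.  The point
    is that [|p(A)|] is at most the supremum of [|p|] on the spectrum, for [A]
    self-adjoint and [p] a real polynomial ([poly_op_spectral_bound]).  With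
    [s = |p(A)|], the operator [p(A)^2 - s^2] is not bounded below; factoring
    [p^2 - s^2] over the complex numbers yields a root [l] with [A - l] not
    bounded below, which is then real and in the spectrum, and [|p(l)| = s].
    Uniqueness, multiplicativity and existence of [f(A)] follow, the last one with
    Bernstein polynomials and the completeness of the space. *)

(** * The underlying real inner product *)

Section RealInner.
Context {R : realType} {H : hilbertType R}.
Implicit Types (x y z : H) (a : R).

(** Boundedness, adjoints and norms only depend on the Hilbert space over the
    reals underlying [H], whose inner product is this one; the complex structure
    comes back in the factorisation of polynomials and in [below_nonreal]. *)
Definition rip x y : R := complex.Re (inner x y).

Lemma ReD (u v : R[i]) : complex.Re (u + v) = complex.Re u + complex.Re v.
Proof. by case: u; case: v. Qed.
Lemma ReM_real a (v : R[i]) : complex.Re (a%:C * v) = a * complex.Re v.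
Proof. by case: v => p q /=; rewrite mul0r subr0. Qed.
Lemma Re_conj (v : R[i]) : complex.Re (Num.conj v) = complex.Re v.
Proof. by case: v. Qed.

Lemma innerC x y : inner x y = Num.conj (inner y x).
Proof. have := @hermC _ _ _ _ (inner : {dot H for @Num.conj R[i]}) x y.
by rewrite /= expr0 mul1r. Qed.

Lemma innerDl x y z : inner (x + y) z = inner x z + inner y z.
Proof. exact: (@linearDl _ _ _ _ _ _ (inner : {dot H for @Num.conj R[i]})). Qed.
Lemma innerZl (c : R[i]) x z : inner (c *: x) z = c * inner x z.
Proof. exact: (@linearZl_LR _ _ _ _ _ _ (inner : {dot H for @Num.conj R[i]})). Qed.

Lemma ripC x y : rip x y = rip y x.
Proof. by rewrite /rip innerC Re_conj. Qed.
Lemma ripDl x y z : rip (x + y) z = rip x z + rip y z.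
Proof. by rewrite /rip innerDl ReD. Qed.
Lemma ripZl a x z : rip (a%:C *: x) z = a * rip x z.
Proof. by rewrite /rip innerZl ReM_real. Qed.

Lemma normr_hnorm x : `|x| = (hnorm x)%:C.
Proof.
have : `|x| \is Num.real by exact: normr_real.
by rewrite /hnorm => /RRe_real.
Qed.

Lemma hnorm_ge0 x : 0 <= hnorm x.
Proof.
have := normr_ge0 x.
by rewrite normr_hnorm lecR.
Qed.

Lemma hnorm_sq x : hnorm x ^+ 2 = rip x x.
Proof. by rewrite /rip -normr_inner normr_hnorm -rmorphXn. Qed.

Lemma hnormZ (c : R[i]) x : hnorm (c *: x) = complex.Re `|c| * hnorm x.
Proof. by rewrite /hnorm normrZ [`|x|]normr_hnorm mulrC ReM_real mulrC. Qed.

Lemma hnormZr a x : hnorm (a%:C *: x) = `|a| * hnorm x.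
Proof. by rewrite hnormZ normc_def /= expr0n addr0 sqrtr_sqr. Qed.

Lemma hnorm0 : hnorm (0 : H) = 0. Proof. by rewrite /hnorm normr0. Qed.

Lemma hnorm_eq0 x : hnorm x = 0 -> x = 0.
Proof. by move=> h; apply: normr0_eq0; rewrite normr_hnorm h. Qed.

Lemma hnorm_opp x : hnorm (- x) = hnorm x. Proof. by rewrite /hnorm normrN. Qed.
Lemma hnorm_distC x y : hnorm (x - y) = hnorm (y - x).
Proof. by rewrite -hnorm_opp opprB. Qed.

Lemma ler_hnormD x y : hnorm (x + y) <= hnorm x + hnorm y.
Proof. by have := ler_normD x y; rewrite !normr_hnorm -rmorphD lecR. Qed.

Lemma ripDr x y z : rip z (x + y) = rip z x + rip z y.
Proof. by rewrite ripC ripDl !(ripC z). Qed.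
Lemma ripZr a x z : rip z (a%:C *: x) = a * rip z x.
Proof. by rewrite ripC ripZl ripC. Qed.
Lemma ripNl x y : rip (- x) y = - rip x y.
Proof. by rewrite -scaleN1r -[-1]/(-(1%:C)) -raddfN ripZl mulN1r. Qed.
Lemma ripNr x y : rip y (- x) = - rip y x.
Proof. by rewrite ripC ripNl ripC. Qed.
Lemma ripBl x y z : rip (x - y) z = rip x z - rip y z.
Proof. by rewrite ripDl ripNl. Qed.
Lemma ripBr x y z : rip z (x - y) = rip z x - rip z y.
Proof. by rewrite ripDr ripNr. Qed.
Lemma rip0l x : rip 0 x = 0.
Proof. by have := ripDl 0 0 x; rewrite addr0; lra. Qed.
Lemma rip0r x : rip x 0 = 0. Proof. by rewrite ripC rip0l. Qed.

Lemma rip_suml (I : Type) (s : seq I) (F : I -> H) z :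
  rip (\sum_(i <- s) F i) z = \sum_(i <- s) rip (F i) z.
Proof.
by elim: s => [|i s ih]; rewrite ?big_nil ?rip0l // !big_cons ripDl ih.
Qed.

Lemma cauchy_schwarz x y : rip x y <= hnorm x * hnorm y.
Proof.
have [x0|x0] := eqVneq (hnorm x) 0.
  by rewrite x0 (hnorm_eq0 x0) rip0l mul0r.
have hx : 0 < hnorm x by rewrite lt_neqAle eq_sym x0 hnorm_ge0.
have : 0 <= hnorm ((hnorm y)%:C *: x - (hnorm x)%:C *: y) ^+ 2 by rewrite sqr_ge0.
rewrite hnorm_sq !(ripBl, ripBr, ripZl, ripZr) (ripC y x) -!hnorm_sq => h.
have : 0 <= 2 * hnorm x * (hnorm y * (hnorm x * hnorm y - rip x y)) by nra.
have [y0|y0] := eqVneq (hnorm y) 0.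
  by rewrite y0 (hnorm_eq0 y0) rip0r mulr0.
have hy : 0 < hnorm y by rewrite lt_neqAle eq_sym y0 hnorm_ge0.
by rewrite pmulr_rge0 ?mulr_gt0// pmulr_rge0// subr_ge0.
Qed.

Lemma rip_norm x y : `|rip x y| <= hnorm x * hnorm y.
Proof.
rewrite ler_norml cauchy_schwarz andbT lerNl -ripNl.
by rewrite (le_trans (cauchy_schwarz _ _))// hnorm_opp.
Qed.

Lemma rip_ext x y : (forall z, rip x z = rip y z) -> x = y.
Proof.
move=> h; apply/eqP; rewrite -subr_eq0; apply/eqP/hnorm_eq0/eqP.
by rewrite -(sqrf_eq0 (hnorm _)) hnorm_sq ripBl h subrr.
Qed.

Lemma parallelogram x y :
  hnorm (x - y) ^+ 2 = 2 * hnorm x ^+ 2 + 2 * hnorm y ^+ 2 - hnorm (x + y) ^+ 2.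
Proof. by rewrite !hnorm_sq !(ripBl, ripBr, ripDl, ripDr) (ripC y x); ring. Qed.

(** Lets the adjoint identity for [inner] be deduced from the one for [rip]. *)
Lemma inner_rip x y : inner x y = rip x y +i* - rip ('i *: x) y.
Proof.
rewrite /rip innerZl; case: (inner x y) => a b /=.
by rewrite mul0r mul1r sub0r opprK.
Qed.

Lemma complete_hnorm (u : nat -> H) :
  (forall e, 0 < e -> exists N, forall m n, (N <= m)%N -> (N <= n)%N ->
     hnorm (u m - u n) <= e) ->
  exists l, forall e, 0 < e -> exists N, forall n, (N <= n)%N -> hnorm (u n - l) <= e.
Proof.
move=> uc.
have : cauchy (u @ \oo).
  apply/cauchy_exP => e e0.
  have [a ea] : exists a : R, e = a%:C by apply/complex_realP; exact: gtr0_real.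
  have a0 : 0 < a by rewrite -ltcR -ea.
  have [N hN] := uc _ (divr_gt0 a0 (ltr0Sn _ 1)).
  exists (u N); exists N => // n Nn; rewrite -ball_normE /ball_/= normr_hnorm ea ltcR.
  by rewrite (le_lt_trans (hN N n _ _))// ltr_pdivrMr// ltr_pMr// ltr1n.
move=> /cauchy_cvgP /cvg_ex[l ul]; exists l => e e0.
have e0C : (0 : R[i]) < e%:C by rewrite ltcR.
have /cvgrPdist_lt/(_ _ e0C)[N _ hN] := ul.
exists N => n Nn; have := hN n Nn.
by rewrite /= normr_hnorm ltcR hnorm_distC => /ltW.
Qed.

Definition opbound (A : H -> H) c := forall x, hnorm (A x) <= c * hnorm x.

Lemma bounded_operatorP (A : H -> H) :
  bounded_operator A <-> linear A /\ exists2 c : R, 0 <= c & opbound A c.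
Proof.
split=> [[lA bA]|[lA [c c0 cA]]].
  split=> //.
  pose lf := GRing.isLinear.Build _ _ _ _ A lA.
  pose f : {linear H -> H} := HB.pack A lf.
  have /pinfty_ex_gt0[r r0 hr] := (linear_boundedP f).1 bA.
  have [a ea] : exists a : R, r = a%:C by apply/complex_realP; exact: gtr0_real.
  exists a; first by rewrite -lecR -ea ltW.
  by move=> x; have := hr x; rewrite /= !normr_hnorm ea -rmorphM lecR.
split=> //; pose lf := GRing.isLinear.Build _ _ _ _ A lA.
pose f : {linear H -> H} := HB.pack A lf.
apply/(linear_boundedP f); exists c%:C; split; first by apply/complex_realP; exists c.
move=> r cr x; rewrite /= [`|A x|]normr_hnorm (le_trans _ (ler_wpM2r _ (ltW cr)))//.
by rewrite normr_hnorm -rmorphM lecR.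
Qed.
End RealInner.

(** * Riesz representation and adjoints *)

Section Linear.
Context {R : realType} {H : hilbertType R}.
Implicit Types (x y z : H) (a : R) (A B : H -> H).

Section OneMap.
Variable A : H -> H.
Hypothesis lA : linear A.
Lemma linD x y : A (x + y) = A x + A y.
Proof. by have := lA 1 x y; rewrite !scale1r. Qed.
Lemma lin0 : A 0 = 0.
Proof. by apply: (@addIr _ (A 0)); rewrite -linD !add0r. Qed.
Lemma linZ (c : R[i]) x : A (c *: x) = c *: A x.
Proof. by have := lA c x 0; rewrite !addr0 lin0 addr0. Qed.
Lemma linN x : A (- x) = - A x.
Proof. by rewrite -scaleN1r linZ scaleN1r. Qed.
Lemma linB x y : A (x - y) = A x - A y.
Proof. by rewrite linD linN. Qed.
End OneMap.

Lemma linear_comp A B : linear A -> linear B -> linear (A \o B).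
Proof. by move=> lA lB c x y /=; rewrite lB lA. Qed.

Lemma bounded_operator_linear A : bounded_operator A -> linear A.
Proof. by case. Qed.

Lemma bounded_operator_comp A B :
  bounded_operator A -> bounded_operator B -> bounded_operator (A \o B).
Proof.
move=> /bounded_operatorP[lA [a a0 hA]] /bounded_operatorP[lB [b b0 hB]].
apply/bounded_operatorP; split; first exact: linear_comp.
exists (a * b); first exact: mulr_ge0.
by move=> x; rewrite /= (le_trans (hA _))// -mulrA ler_wpM2l.
Qed.

(** The representing vector minimises [J x = |x|^2 - 2 psi x].  A minimising
    sequence is Cauchy by the parallelogram law, and at its limit the first
    variation of [J] vanishes in every direction. *)
Lemma riesz_real (psi : H -> R) (c : R) :
  (forall x y, psi (x + y) = psi x + psi y) ->
  (forall a x, psi (a%:C *: x) = a * psi x) ->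
  (forall x, `|psi x| <= c * hnorm x) ->
  exists z, forall x, psi x = rip x z.
Proof.
move=> psiD psiZ psib.
pose J x := hnorm x ^+ 2 - 2 * psi x.
have Jlb x : - c ^+ 2 <= J x.
  have := psib x; rewrite ler_norml => /andP[_ h]; rewrite /J.
  have : 0 <= (hnorm x - c) ^+ 2 by rewrite sqr_ge0.
  by nra.
pose m := inf (range J).
have hinf : has_inf (range J).
  by split; [exists (J 0); exists 0|exists (- c ^+ 2) => _ [x _ <-]].
have mJ x : m <= J x by apply: ge_inf; [exact: hinf.2|exists x].
have Jmid x y : hnorm (x - y) ^+ 2 <= 2 * (J x + J y - 2 * m).
  have := mJ (2^-1%:C *: (x + y)); rewrite /J parallelogram hnormZr psiZ psiD.
  rewrite exprMn normfV (ger0_norm (ler0n _ 2)) => h.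
  have e4 : (2^-1 : R) ^+ 2 = 4^-1 by rewrite exprVn -natrX.
  rewrite e4 in h.
  by lra.
have ex n : exists x, J x < m + n.+1%:R^-1.
  have n0 : 0 < n.+1%:R^-1 :> R by rewrite invr_gt0.
  have [_ [x _ <-] h] := inf_adherent n0 hinf.
  by exists x.
have [u hu] := choice ex.
have [l hl] : exists l, forall e, 0 < e -> exists N, forall n, (N <= n)%N -> hnorm (u n - l) <= e.
  (* [Jmid] turns nearly minimal values of [J] into small distances *)
  apply: complete_hnorm => e e0.
  have e40 : 0 < e ^+ 2 / 4 by rewrite divr_gt0// exprn_gt0.
  have [N hN] := ltr_add_invr (y := 0) (x := e ^+ 2 / 4) e40.
  rewrite add0r in hN.
  have hk k : (N <= k)%N -> J (u k) <= m + e ^+ 2 / 4.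
    move=> Nk; rewrite (le_trans (ltW (hu k)))// lerD2l (le_trans _ (ltW hN))//.
    by rewrite lef_pV2 ?posrE// ler_nat.
  exists N => p q Np Nq.
  rewrite -(ler_pXn2r (n := 2)) ?nnegrE ?hnorm_ge0 ?(ltW e0)//.
  have := Jmid (u p) (u q); have := hk p Np; have := hk q Nq; lra.
exists l => h.
have key k : 0 <= hnorm k ^+ 2 + 2 * (rip l k - psi k).
  apply/ler_addgt0Pr => e e0.
  pose K := hnorm k + 1.
  have K0 : 0 < K by rewrite ltr_pwDr ?hnorm_ge0.
  have [N1 hN1] := ltr_add_invr (y := 0) (x := e / 2) (divr_gt0 e0 (ltr0Sn _ 1)).
  rewrite add0r in hN1.
  have [N2 hN2] : exists N, forall n, (N <= n)%N -> hnorm (u n - l) <= e / (4 * K).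
    by apply: hl; rewrite divr_gt0 ?mulr_gt0.
  pose n := maxn N1 N2.
  have h1 : J (u n) <= m + e / 2.
    rewrite (le_trans (ltW (hu n)))// lerD2l (le_trans _ (ltW hN1))//.
    by rewrite lef_pV2 ?posrE// ler_nat ltnS leq_maxl.
  have h2 : rip (u n - l) k <= e / 4.
    rewrite (le_trans (cauchy_schwarz _ _))//.
    have h3 := hN2 n (leq_maxr _ _).
    have h4 : hnorm k <= K by rewrite lerDl.
    apply: (le_trans (ler_pM (hnorm_ge0 _) (hnorm_ge0 _) h3 h4)).
    by rewrite [leLHS](_ : _ = e / 4)//; field; rewrite gt_eqF.
  have := mJ (u n + k); move: h1; rewrite /J psiD !hnorm_sq !(ripDl, ripDr).
  rewrite ripBl in h2; rewrite (ripC k (u n)) => h1 h5.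
  by lra.
have sq t : 0 <= t ^+ 2 * hnorm h ^+ 2 + 2 * t * (rip l h - psi h).
  have := key (t%:C *: h); rewrite hnormZr psiZ ripZr exprMn -normrX ger0_norm ?sqr_ge0//.
  by lra.
set a := hnorm h ^+ 2 in sq; set b := rip l h - psi h in sq.
have a0 : 0 <= a by rewrite sqr_ge0.
have a1 : 0 < a + 1 by rewrite ltr_wpDl.
(* [-b/a] would be the minimiser of the quadratic; [a + 1] avoids [a = 0] *)
have := sq (- b / (a + 1)).
have -> : (- b / (a + 1)) ^+ 2 * a + 2 * (- b / (a + 1)) * b =
  - (b ^+ 2 * (a + 2) / (a + 1) ^+ 2) by field; rewrite gt_eqF.
rewrite oppr_ge0 pmulr_lle0 ?invr_gt0 ?exprn_gt0// pmulr_lle0 ?ltr_wpDl//.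
move=> b2; have /eqP : b ^+ 2 = 0 by apply/eqP; rewrite eq_le b2 sqr_ge0.
by rewrite sqrf_eq0 => /eqP/subr0_eq <-; rewrite ripC.
Qed.

Lemma adjointP A : bounded_operator A ->
  forall x y, inner (A x) y = inner x (adjoint A y).
Proof.
move=> /bounded_operatorP[lA [c c0 hA]] x y.
have [z hz] : exists z, forall x, rip (A x) y = rip x z.
  apply: (@riesz_real _ (c * hnorm y)) => [u v|a u|u].
  - by rewrite linD// ripDl.
  - by rewrite linZ// ripZl.
  - rewrite (le_trans (rip_norm _ _))// mulrAC ler_wpM2r ?hnorm_ge0//.
have : [set z | forall x, inner (A x) y = inner x z] (adjoint A y).
  apply: (xgetPex 0); exists z => u /=.
  by rewrite !inner_rip -linZ// !hz.
exact.
Qed.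

Lemma rip_adjoint A : bounded_operator A ->
  forall x y, rip (A x) y = rip x (adjoint A y).
Proof. by move=> bA x y; rewrite /rip adjointP. Qed.

End Linear.

(** * Tuples as column operators *)

Section Tuples.
Context {R : realType} {H : hilbertType R}.
Variable d : nat.
Implicit Types (x y z : H) (S T : 'I_d -> H -> H).

(** The squared norm, in the direct sum of [d] copies of [H], of the column
    [S] applied to [x]. *)
Definition tsq S x : R := \sum_k hnorm (S k x) ^+ 2.

Lemma tsq_ge0 S x : 0 <= tsq S x.
Proof. by apply: sumr_ge0 => k _; rewrite sqr_ge0. Qed.

Lemma tuple_norm_le S (c : R) : 0 <= c ->
  (forall x, tsq S x <= c ^+ 2 * hnorm x ^+ 2) -> tuple_norm S <= c.
Proof.
move=> c0 h; rewrite /tuple_norm.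
have [->|/set0P ne] := eqVneq [set Num.sqrt (tsq S x) | x in [set x | hnorm x = 1]] set0.
  by rewrite sup0.
apply: ge_sup => // _ [x /= x1 <-].
rewrite -[leRHS](ger0_norm c0) -sqrtr_sqr; apply: ler_wsqrtr.
by have := h x; rewrite x1 expr1n mulr1.
Qed.


Section BoundedTuple.
Variable S : 'I_d -> H -> H.
Hypothesis bS : forall k, bounded_operator (S k).

(** Makes the set whose supremum defines [tuple_norm] bounded, so that the
    supremum is a genuine one. *)
Lemma tsq_bound : exists2 c : R, 0 <= c & forall x, tsq S x <= c ^+ 2 * hnorm x ^+ 2.
Proof.
have /choice[c hc] k : exists c : R, 0 <= c /\ opbound (S k) c.
  by have /bounded_operatorP[_ [c c0 hc]] := bS k; exists c.
exists (\sum_k c k); first by apply: sumr_ge0 => k _; exact: (hc k).1.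
move=> x; apply: (@le_trans _ _ ((\sum_k c k ^+ 2) * hnorm x ^+ 2)).
  rewrite big_distrl; apply: ler_sum => k _ /=.
  have h := (hc k).2 x.
  by rewrite -exprMn ler_pXn2r ?nnegrE ?mulr_ge0 ?hnorm_ge0 ?(hc k).1.
rewrite ler_wpM2r ?sqr_ge0//.
rewrite expr2 big_distrl; apply: ler_sum => k _ /=.
rewrite expr2 ler_wpM2l ?(hc k).1// (bigD1 k)//= lerDl.
by apply: sumr_ge0 => j _; exact: (hc j).1.
Qed.

Let E := [set Num.sqrt (tsq S x) | x in [set x | hnorm x = 1]].

Let ubE : has_ubound E.
Proof.
have [c c0 hc] := tsq_bound; exists c => _ [x /= x1 <-].
rewrite -[leRHS](ger0_norm c0) -sqrtr_sqr; apply: ler_wsqrtr.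
by have := hc x; rewrite x1 expr1n mulr1.
Qed.

Lemma tuple_norm_ge0 : 0 <= tuple_norm S.
Proof.
rewrite /tuple_norm -/E; have [->|/set0P[r Er]] := eqVneq E set0; first by rewrite sup0.
apply: le_trans (ub_le_sup ubE Er).
by case: Er => x _ <-; exact: sqrtr_ge0.
Qed.

Lemma tsq_scale (a : R) x : tsq S (a%:C *: x) = a ^+ 2 * tsq S x.
Proof.
rewrite /tsq big_distrr; apply: eq_bigr => k _ /=.
by rewrite (linZ (bounded_operator_linear (bS k))) hnormZr exprMn -normrX ger0_norm ?sqr_ge0.
Qed.

Lemma tsq_le x : tsq S x <= tuple_norm S ^+ 2 * hnorm x ^+ 2.
Proof.
have [x0|x0] := eqVneq (hnorm x) 0.
  have [c _ /(_ x)] := tsq_bound.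
  by rewrite x0 expr0n /= !mulr0.
have hx : 0 < hnorm x by rewrite lt_neqAle eq_sym x0 hnorm_ge0.
have : Num.sqrt (tsq S ((hnorm x)^-1%:C *: x)) <= tuple_norm S.
  apply: (ub_le_sup ubE); exists ((hnorm x)^-1%:C *: x) => //=.
  by rewrite hnormZr ger0_norm ?invr_ge0 ?hnorm_ge0// mulVf.
rewrite tsq_scale -(ler_pXn2r (n := 2)) ?nnegrE ?sqrtr_ge0 ?tuple_norm_ge0//.
rewrite sqr_sqrtr; last by rewrite mulr_ge0 ?tsq_ge0 ?sqr_ge0.
by rewrite exprVn ler_pdivrMl ?exprn_gt0// => h; rewrite mulrC.
Qed.

Lemma tuple_norm_adherent (e : R) : (exists x, hnorm x = 1) -> 0 < e ->
  exists2 x, hnorm x = 1 & tuple_norm S ^+ 2 - e <= tsq S x.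
Proof.
move=> [x0 hx0] e0.
have hs : has_sup E by split; [exists (Num.sqrt (tsq S x0)), x0|exact: ubE].
pose s := tuple_norm S; have s0 : 0 <= s := tuple_norm_ge0.
have d0 : 0 < e / (2 * (s + 1)) by rewrite divr_gt0 ?mulr_gt0 ?ltr_wpDl.
have [_ [x /= x1 <-] h] := sup_adherent d0 hs.
exists x => //; move: h; rewrite -/(tuple_norm S) -/s.
set del := e / _ => h.
have [sd|sd] := leP s del.
  have : s ^+ 2 <= e.
    have : s * del <= e / 2.
      rewrite /del mulrA ler_pdivrMr ?mulr_gt0 ?ltr_wpDl//; nra.
    nra.
  by move=> ?; rewrite (le_trans _ (tsq_ge0 _ _))// subr_le0.
have : (s - del) ^+ 2 <= Num.sqrt (tsq S x) ^+ 2.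
  by rewrite ler_pXn2r ?nnegrE ?sqrtr_ge0 ?subr_ge0 ?(ltW sd)// ltW.
rewrite sqr_sqrtr ?tsq_ge0//; apply: le_trans.
have : s * del <= e / 2.
  rewrite /del mulrA ler_pdivrMr ?mulr_gt0 ?ltr_wpDl//; nra.
have : 0 <= del ^+ 2 by rewrite sqr_ge0.
by nra.
Qed.

Lemma rip_gram x z : rip (gram S x) z = \sum_k rip (S k x) (S k z).
Proof.
rewrite /gram rip_suml; apply: eq_bigr => k _.
by rewrite ripC -rip_adjoint// ripC.
Qed.

Lemma rip_gram_sq x : rip (gram S x) x = tsq S x.
Proof. by rewrite rip_gram; apply: eq_bigr => k _; rewrite hnorm_sq. Qed.

End BoundedTuple.

(** The Cauchy-Schwarz inequality of the direct sum of [d] copies of [H], by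
    optimising over [t] the inequality [0 <= sum_k |t u_k - v_k|^2]. *)
Lemma sum_rip_le (u v : 'I_d -> H) :
  \sum_k rip (u k) (v k) <=
    Num.sqrt (\sum_k hnorm (u k) ^+ 2) * Num.sqrt (\sum_k hnorm (v k) ^+ 2).
Proof.
set a := Num.sqrt _; set b := Num.sqrt _.
have a2 : a ^+ 2 = \sum_k hnorm (u k) ^+ 2.
  by rewrite sqr_sqrtr// sumr_ge0// => k _; rewrite sqr_ge0.
have b2 : b ^+ 2 = \sum_k hnorm (v k) ^+ 2.
  by rewrite sqr_sqrtr// sumr_ge0// => k _; rewrite sqr_ge0.
have key (t : R) : 2 * t * \sum_k rip (u k) (v k) <= t ^+ 2 * a ^+ 2 + b ^+ 2.
  rewrite a2 b2 !big_distrr -big_split /=; apply: ler_sum => k _.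
  have : 0 <= hnorm (t%:C *: u k - v k) ^+ 2 by rewrite sqr_ge0.
  rewrite [X in 0 <= X]hnorm_sq !(ripBl, ripBr, ripZl, ripZr) (ripC (v k)) -!hnorm_sq; lra.
have a0 : 0 <= a := sqrtr_ge0 _; have b0 : 0 <= b := sqrtr_ge0 _.
set w := \sum_k _ in key *; clearbody a b w.
have [az|az] := eqVneq a 0.
  rewrite az mul0r leNgt; apply/negP => sp.
  have := key ((b ^+ 2 + 1) / w).
  rewrite az expr0n /= mulr0 add0r -mulrA divfK ?gt_eqF//.
  by have := sqr_ge0 b; lra.
have ap : 0 < a by rewrite lt_neqAle eq_sym az.
have [w0|w0] := ltP w 0; first by rewrite (le_trans (ltW w0))// mulr_ge0.
rewrite -(ler_pXn2r (n := 2)) ?nnegrE ?mulr_ge0//.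
have := key (w / a ^+ 2).
have -> : 2 * (w / a ^+ 2) * w = 2 * (w ^+ 2 / a ^+ 2) by field.
have -> : (w / a ^+ 2) ^+ 2 * a ^+ 2 = w ^+ 2 / a ^+ 2 by field.
move=> h; have : w ^+ 2 / a ^+ 2 <= b ^+ 2 by lra.
by rewrite ler_pdivrMr ?exprn_gt0// exprMn mulrC.
Qed.

Section GramNorm.
Variable S : 'I_d -> H -> H.
Hypothesis bS : forall k, bounded_operator (S k).

Lemma hnorm_gram x : hnorm (gram S x) ^+ 2 <= tuple_norm S ^+ 2 * tsq S x.
Proof.
have s0 := tuple_norm_ge0 bS.
have : hnorm (gram S x) ^+ 2 <= Num.sqrt (tsq S x) * (tuple_norm S * hnorm (gram S x)).
  rewrite hnorm_sq rip_gram// (le_trans (sum_rip_le _ _))// ler_wpM2l ?sqrtr_ge0//.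
  rewrite -[leRHS]ger0_norm ?mulr_ge0 ?hnorm_ge0// -sqrtr_sqr ler_wsqrtr//.
  by rewrite exprMn; exact: tsq_le.
have [->|g0] := eqVneq (hnorm (gram S x)) 0.
  by rewrite expr0n /= => _; rewrite mulr_ge0 ?sqr_ge0 ?tsq_ge0.
have gp : 0 < hnorm (gram S x) by rewrite lt_neqAle eq_sym g0 hnorm_ge0.
rewrite {1}expr2 mulrA ler_pM2r// => h.
rewrite -[X in _ <= _ * X]sqr_sqrtr ?tsq_ge0// -exprMn ler_pXn2r ?nnegrE ?hnorm_ge0 ?mulr_ge0 ?sqrtr_ge0//.
by rewrite mulrC.
Qed.

(** If a unit vector [x] nearly attains the norm [s] of the column [S], it is
    nearly an eigenvector of [S*S], because
    [|S*S x - s^2 x|^2 = |S*S x|^2 - 2 s^2 |S x|^2 + s^4 <= s^2 (s^2 - |S x|^2)]. *)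
Lemma gram_approx_eigen (e : R) : (exists x, hnorm x = 1) -> 0 < e ->
  exists x, [/\ hnorm x = 1, tuple_norm S ^+ 2 - e <= tsq S x &
    hnorm (gram S x - (tuple_norm S ^+ 2)%:C *: x) <= e].
Proof.
move=> ex e0; set s := tuple_norm S.
have s0 : 0 <= s := tuple_norm_ge0 bS.
pose del := Num.min e (e ^+ 2 / (s ^+ 2 + 1)).
have s1 : 0 < s ^+ 2 + 1 by rewrite ltr_wpDl ?sqr_ge0.
have d0 : 0 < del by rewrite lt_min e0 divr_gt0 ?exprn_gt0.
have [x x1 hx] := tuple_norm_adherent bS ex d0; rewrite -/s in hx.
exists x; split=> //.
  by apply: le_trans hx; rewrite lerB// ge_min lexx.
rewrite -(ler_pXn2r (n := 2)) ?nnegrE ?hnorm_ge0 ?(ltW e0)//.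
rewrite hnorm_sq !(ripBl, ripBr, ripZl, ripZr) (ripC x) rip_gram_sq// -!hnorm_sq x1.
have := hnorm_gram x; rewrite -/s => hg.
have : s ^+ 2 * del <= e ^+ 2.
  have h : del <= e ^+ 2 / (s ^+ 2 + 1) by rewrite ge_min lexx orbT.
  have : del * (s ^+ 2 + 1) <= e ^+ 2 by rewrite -ler_pdivlMr.
  by nra.
have := sqr_ge0 s.
by nra.
Qed.
End GramNorm.
End Tuples.

(** * Polynomials in an operator and their norm on the spectrum *)

Section Poly.
Context {R : realType} {H : hilbertType R}.
Implicit Types (x y z : H) (A B C : H -> H) (p q : {poly R[i]}).

Definition symmetric_op A := forall x y, rip (A x) y = rip x (A y).

(** Complex coefficients are needed to split polynomials into linear factors. *)
Definition cpoly_op p A x : H := \sum_(k < size p) p`_k *: iter k A x.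

Lemma cpoly_opE n p A x : (size p <= n)%N ->
  cpoly_op p A x = \sum_(k < n) p`_k *: iter k A x.
Proof.
move=> pn; rewrite /cpoly_op (big_ord_widen n (fun k => p`_k *: iter k A x) pn).
rewrite big_mkcond; apply: eq_bigr => k _.
by case: ifPn => //; rewrite -leqNgt => h; rewrite nth_default// scale0r.
Qed.

Lemma cpoly_opD p q A x : cpoly_op (p + q) A x = cpoly_op p A x + cpoly_op q A x.
Proof.
pose n := maxn (size p) (size q).
rewrite !(@cpoly_opE n) ?size_polyD ?leq_maxl ?leq_maxr// -big_split /=.
by apply: eq_bigr => k _; rewrite coefD scalerDl.
Qed.

Lemma cpoly_opZ c p A x : cpoly_op (c *: p) A x = c *: cpoly_op p A x.
Proof.
rewrite !(@cpoly_opE (size p)) ?size_scale_leq// scaler_sumr.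
by apply: eq_bigr => k _; rewrite coefZ scalerA.
Qed.

Lemma cpoly_op0 A x : cpoly_op 0 A x = 0.
Proof. by rewrite (@cpoly_opE 0) ?size_poly0// big_ord0. Qed.

Lemma cpoly_opC c A x : cpoly_op c%:P A x = c *: x.
Proof. by rewrite (@cpoly_opE 1) ?size_polyC_leq1// big_ord1 coefC. Qed.

Lemma cpoly_opMX p A x : cpoly_op (p * 'X) A x = cpoly_op p A (A x).
Proof.
rewrite (@cpoly_opE (size p).+1); last first.
  by rewrite (leq_trans (size_polyMleq _ _))// size_polyX addn2.
rewrite big_ord_recl coefMX scale0r add0r /cpoly_op.
by apply: eq_bigr => k _; rewrite /= coefMX /= -iterSr.
Qed.

Lemma cpoly_op_MXaddC p c A x :
  cpoly_op (p * 'X + c%:P) A x = cpoly_op p A (A x) + c *: x.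
Proof. by rewrite cpoly_opD cpoly_opMX cpoly_opC. Qed.

Lemma cpoly_op_linear p A : linear A -> linear (cpoly_op p A).
Proof.
move=> lA; elim/poly_ind: p => [c x y|p c IH a x y].
  by rewrite !cpoly_op0 scaler0 addr0.
rewrite !cpoly_op_MXaddC lA IH !scalerDr !scalerA (mulrC c a) -!addrA.
by congr (_ + _); rewrite addrCA.
Qed.

Lemma cpoly_opM p q A x : linear A ->
  cpoly_op (p * q) A x = cpoly_op p A (cpoly_op q A x).
Proof.
move=> lA; elim/poly_ind: q x => [x|q c IH x].
  by rewrite mulr0 !cpoly_op0 (lin0 (cpoly_op_linear p lA)).
rewrite mulrDr mulrA cpoly_opD cpoly_opMX IH mulrC mul_polyC cpoly_opZ.
rewrite cpoly_op_MXaddC (linD (cpoly_op_linear p lA)).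
by rewrite (linZ (cpoly_op_linear p lA)).
Qed.

Lemma poly_opE (p : {poly R}) A x :
  poly_op p A x = cpoly_op (map_poly (real_complex R) p) A x.
Proof.
rewrite (@cpoly_opE (size p)) ?size_map_poly//.
by apply: eq_bigr => k _; rewrite coef_map.
Qed.

Section LinearA.
Variable A : H -> H.
Hypothesis lA : linear A.
Implicit Types (r s : {poly R}).

Lemma poly_op_linear r : linear (poly_op r A).
Proof. by move=> c x y; rewrite !poly_opE; exact: cpoly_op_linear. Qed.
Lemma poly_opD r s x : poly_op (r + s) A x = poly_op r A x + poly_op s A x.
Proof. by rewrite !poly_opE rmorphD cpoly_opD. Qed.
Lemma poly_opC a x : poly_op a%:P A x = a%:C *: x.
Proof. by rewrite poly_opE map_polyC cpoly_opC. Qed.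
Lemma poly_opM r s x : poly_op (r * s) A x = poly_op r A (poly_op s A x).
Proof. by rewrite !poly_opE rmorphM cpoly_opM. Qed.
Lemma poly_opX x : poly_op 'X A x = A x.
Proof. by rewrite poly_opE map_polyX -['X]mul1r cpoly_opMX cpoly_opC scale1r. Qed.
Lemma poly_opN r x : poly_op (- r) A x = - poly_op r A x.
Proof. by rewrite -mulN1r poly_opM -[-1]/(-(1%:P)) -rmorphN poly_opC rmorphN scaleN1r. Qed.
Lemma poly_opB r s x : poly_op (r - s) A x = poly_op r A x - poly_op s A x.
Proof. by rewrite poly_opD poly_opN. Qed.

Lemma poly_op_symmetric r : symmetric_op A -> symmetric_op (poly_op r A).
Proof.
move=> sA; elim/poly_ind: r => [x y|r c IH x y].
  by rewrite !poly_opC !scale0r rip0l rip0r.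
rewrite !poly_opD !poly_opM !poly_opC !poly_opX ripDl ripDr ripZl ripZr IH sA.
by rewrite -!poly_opX -!poly_opM mulrC.
Qed.

Lemma poly_op_bounded r : bounded_operator A -> bounded_operator (poly_op r A).
Proof.
move=> /bounded_operatorP[_ [c c0 cA]]; apply/bounded_operatorP.
split; first exact: poly_op_linear.
elim/poly_ind: r => [|r a [b b0 IH]].
  by exists 0 => // x; rewrite poly_opC scale0r hnorm0 mul0r.
exists (b * c + `|a|); first by rewrite addr_ge0// mulr_ge0.
move=> x; rewrite poly_opD poly_opM poly_opX poly_opC.
rewrite (le_trans (ler_hnormD _ _))// mulrDl hnormZr lerD//.
by rewrite (le_trans (IH _))// -mulrA ler_wpM2l.
Qed.
End LinearA.

Definition below A (c : R) := forall x, c * hnorm x <= hnorm (A x).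

(** The polynomial splits into linear factors, and a composition of operators
    bounded below is bounded below. *)
Lemma cpoly_op_below A q : linear A -> q != 0 ->
  (forall l, root q l -> exists2 c : R, 0 < c & below (fun x => A x - l *: x) c) ->
  exists2 c : R, 0 < c & below (cpoly_op q A) c.
Proof.
move=> lA q0 hq; have [rs qE] := closed_field_poly_normal q.
have lq : lead_coef q != 0 by rewrite lead_coef_eq0.
have : forall l, l \in rs -> exists2 c : R, 0 < c & below (fun x => A x - l *: x) c.
  by move=> l lrs; apply: hq; rewrite qE rootZ// root_prod_XsubC.
rewrite qE; elim: rs {qE hq} => [_|l rs IH h].
  exists (complex.Re `|lead_coef q|).
    by rewrite -ltcR RRe_real ?normr_real// normr_gt0.
  by move=> x; rewrite big_nil alg_polyC cpoly_opC hnormZ.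
have [|c c0 hc] := IH; first by move=> l0 lrs; apply: h; rewrite inE lrs orbT.
have [b b0 hb] := h l (mem_head _ _).
exists (c * b); first exact: mulr_gt0.
move=> x; rewrite big_cons [_ * \prod_(_ <- _) _]mulrC scalerAl cpoly_opM//.
apply: le_trans (hc _); rewrite -mulrA ler_wpM2l ?(ltW c0)//.
apply: le_trans (hb x) _.
by rewrite -polyCN -['X]mul1r -[1]/(1%:P) cpoly_op_MXaddC cpoly_opC scale1r scaleNr.
Qed.

Lemma below_not_spectrum A (a : R[i]) : ~ spectrum A a ->
  exists2 c : R, 0 < c & below (fun x => A x - a *: x) c.
Proof.
move=> /contrapT[B [bB BA _]].
have /bounded_operatorP[lB [c c0 hc]] := bB.
have c1 : 0 < c + 1 by rewrite ltr_wpDl.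
exists (c + 1)^-1; first by rewrite invr_gt0.
move=> x; rewrite ler_pdivrMl//; have := hc (A x - a *: x); rewrite BA => h.
by rewrite (le_trans h)// ler_wpM2r ?hnorm_ge0// lerDl.
Qed.

(** For [l = u + i v], the vectors [(A - u) x] and [v i x] are orthogonal in the
    real inner product, so the second alone bounds the norm of their difference. *)
Lemma below_nonreal A (l : R[i]) : linear A -> symmetric_op A ->
  complex.Im l != 0 -> below (fun x => A x - l *: x) `|complex.Im l|.
Proof.
move=> lA sA; case: l => u v /= v0 x.
rewrite -(ler_pXn2r (n := 2)) ?nnegrE ?mulr_ge0 ?hnorm_ge0//.
have -> : A x - (u +i* v) *: x = (A x - u%:C *: x) - v%:C *: ('i *: x).
  rewrite -addrA -opprD scalerA -scalerDl; congr (_ - _ *: _).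
  by simpc.
have sy : rip (A x - u%:C *: x) ('i *: x) = 0.
  have ix y : rip ('i *: y) y = 0.
    rewrite /rip innerZl -normr_inner normr_hnorm -rmorphXn /=; by simpc.
  have ixy y z : rip ('i *: y) ('i *: z) = rip y z.
    suff e y' : rip ('i *: y') ('i *: y') = rip y' y'.
      have := e (y + z); rewrite scalerDr !(ripDl, ripDr) !e.
      by rewrite (ripC z) (ripC ('i *: z)); lra.
    by rewrite -!hnorm_sq hnormZ normc_def /= expr0n expr1n add0r sqrtr1 mul1r.
  rewrite ripBl ripZl [rip x _]ripC ix mulr0 subr0.
  have h1 : rip (A x) ('i *: x) = rip ('i *: A x) x by rewrite sA linZ// ripC.
  have h2 : rip (A x) ('i *: x) = - rip ('i *: A x) x.
    rewrite -[LHS]ixy scalerA -expr2 sqr_i scaleN1r ripNr //.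
  by lra.
set P := A x - _ in sy *; clearbody P.
have -> : hnorm (P - v%:C *: ('i *: x)) ^+ 2 = hnorm P ^+ 2 + v ^+ 2 * hnorm ('i *: x) ^+ 2.
  rewrite !hnorm_sq ripBl !ripBr !ripZl !ripZr. rewrite (ripC ('i *: x) P) sy.
  by rewrite !mulr0 subr0 sub0r opprK mulrA.
rewrite exprMn -normrX ger0_norm ?sqr_ge0//.
have -> : hnorm ('i *: x) = hnorm x.
  by rewrite hnormZ normc_def /= expr0n expr1n add0r sqrtr1 mul1r.
by rewrite lerDr sqr_ge0.
Qed.

Section SpectralBound.
Variable A : H -> H.
Hypotheses (bA : bounded_operator A) (sA : symmetric_op A).
Let lA := bounded_operator_linear bA.

Lemma spectrum_root (q : {poly R}) : q != 0 ->
  (forall c : R, 0 < c -> exists x, hnorm (poly_op q A x) < c * hnorm x) ->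
  exists2 a : R, spectrum A a%:C & root q a.
Proof.
move=> q0 hq; apply: contrapT => hn.
have [||c c0 hc] := @cpoly_op_below A (map_poly (real_complex R) q) lA.
- by rewrite map_poly_eq0.
- move=> [u v] rl; have [v0|v0] := eqVneq v 0; last first.
    exists `|v|; first by rewrite normr_gt0.
    exact: (@below_nonreal _ (u +i* v)).
  rewrite {}v0 in rl *; apply: below_not_spectrum => su; apply: hn; exists u => //.
  by rewrite -(fmorph_root (real_complex R)).
have [x] := hq c c0; rewrite poly_opE => /lt_geF; rewrite hc //.
Qed.

(** The approximate eigenvectors of [gram_approx_eigen], for the one-entry tuple
    [p(A)], whose Gram operator is [p(A)^2]. *)
Lemma poly_op_near_norm (p : {poly R}) (c : R) : (exists x : H, hnorm x = 1) -> 0 < c ->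
  let s := tuple_norm (fun _ : 'I_1 => poly_op p A) in
  exists x, hnorm (poly_op (p ^+ 2 - (s ^+ 2)%:P) A x) < c * hnorm x.
Proof.
move=> ex c0 s.
have bS (k : 'I_1) : bounded_operator (poly_op p A) by exact: poly_op_bounded.
have [x [x1 _ hx]] := gram_approx_eigen bS ex (divr_gt0 c0 (ltr0Sn _ 1)).
exists x; rewrite x1 mulr1 poly_opB// poly_opC expr2 poly_opM//.
rewrite (_ : poly_op p A _ = gram (fun _ : 'I_1 => poly_op p A) x); last first.
  apply: rip_ext => z; rewrite rip_gram// big_ord1.
  by rewrite poly_op_symmetric.
by rewrite (le_lt_trans hx)// ltr_pdivrMr// ltr_pMr// ltr1n.
Qed.

(** Needed to bound [p(A)] when [p^2] is constant, since then [p^2 - |p(A)|^2]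
    may be the zero polynomial and gives no root. *)
Lemma spectrum_nonempty : (exists x : H, hnorm x = 1) -> exists a : R, spectrum A a%:C.
Proof.
move=> ex; pose s := tuple_norm (fun _ : 'I_1 => poly_op 'X A).
have [||a sa _] := @spectrum_root ('X ^+ 2 - (s ^+ 2)%:P).
- by rewrite -size_poly_gt0 size_XnsubC.
- by move=> c c0; exact: poly_op_near_norm.
by exists a.
Qed.

(** The bound that makes the functional calculus well defined: polynomials which
    are close on the spectrum alone give operators which are close in norm. *)
Lemma poly_op_spectral_bound (p : {poly R}) (m : R) : 0 <= m ->
  (forall a, spectrum A a%:C -> `|p.[a]| <= m) ->
  forall x, hnorm (poly_op p A x) <= m * hnorm x.
Proof.
move=> m0 hm x.
have [x0|x0] := eqVneq (hnorm x) 0.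
  by rewrite x0 (hnorm_eq0 x0) (lin0 (poly_op_linear lA p)) hnorm0 mulr0.
have ex : exists x : H, hnorm x = 1.
  exists ((hnorm x)^-1%:C *: x).
  by rewrite hnormZr ger0_norm ?invr_ge0 ?hnorm_ge0// mulVf.
pose s := tuple_norm (fun _ : 'I_1 => poly_op p A).
have bS (k : 'I_1) : bounded_operator (poly_op p A) by exact: poly_op_bounded.
have s0 : 0 <= s := tuple_norm_ge0 bS.
have [a sa pa] : exists2 a : R, spectrum A a%:C & root (p ^+ 2 - (s ^+ 2)%:P) a.
  (* the zero polynomial has every point of the spectrum as a root *)
  have [q0|q0] := eqVneq (p ^+ 2 - (s ^+ 2)%:P) 0.
    by have [a sa] := spectrum_nonempty ex; exists a => //; rewrite q0 root0.
  by apply: spectrum_root => // c c0; exact: poly_op_near_norm.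
have sm : s <= m.
  apply: le_trans (hm _ sa).
  move/rootP: pa; rewrite !hornerE => /eqP; rewrite subr_eq0 => /eqP e.
  by rewrite -sqrtr_sqr e sqrtr_sqr ler_norm.
have := tsq_le bS x; rewrite /tsq big_ord1 -/s => h.
rewrite -(ler_pXn2r (n := 2)) ?nnegrE ?mulr_ge0 ?hnorm_ge0//.
rewrite (le_trans h)// exprMn ler_wpM2r ?sqr_ge0//.
by rewrite ler_pXn2r ?nnegrE.
Qed.
End SpectralBound.
End Poly.

(** * Location of the spectrum of a positive operator *)

Section Neumann.
Context {R : realType} {H : hilbertType R}.
Implicit Types (x y z : H) (A B C : H -> H).

(** The solution of [l = y + C l] is the limit of the iterates
    [u_(n+1) = y + C u_n], and it is unique since [C] is a strict contraction. *)
Lemma neumann C (q : R) : linear C -> 0 <= q < 1 -> opbound C q ->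
  exists B, [/\ bounded_operator B, forall x, B (x - C x) = x &
    forall x, B x - C (B x) = x].
Proof.
move=> lC /andP[q0 q1] hC; have q1' : 0 < 1 - q by rewrite subr_gt0.
have uniq0 x : x = C x -> x = 0.
  move=> xC; apply: hnorm_eq0; have := hC x; rewrite -xC => h.
  by apply/eqP; rewrite eq_le hnorm_ge0 andbT; have := hnorm_ge0 x; nra.
have sol y : exists l, l = y + C l.
  pose u := fix u n := if n is n'.+1 then y + C (u n') else 0.
  pose K := hnorm y / (1 - q).
  have K0 : 0 <= K by rewrite divr_ge0 ?hnorm_ge0 ?ltW.
  have KE : hnorm y + q * K = K by rewrite /K; field; rewrite gt_eqF.
  have uK k : hnorm (u k) <= K.
    elim: k => [|k IH]; first by rewrite /= hnorm0.
    by rewrite /= (le_trans (ler_hnormD _ _))// -KE lerD2l (le_trans (hC _))// ler_wpM2l.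
  have uq n k : hnorm (u (n + k)%N - u n) <= q ^+ n * K.
    elim: n => [|n IH]; first by rewrite /= subr0 mul1r.
    rewrite addSn /= opprD addrACA subrr add0r -linB// (le_trans (hC _))//.
    by rewrite exprS -mulrA ler_wpM2l.
  have qe e : 0 < e -> exists N, q ^+ N * K <= e.
    move=> e0; have K1 : 0 < K + 1 by rewrite ltr_wpDl.
    have qn : `|q| < 1 by rewrite ger0_norm.
    have /cvgrPdist_le/(_ _ (divr_gt0 e0 K1))[N _ hN] := cvg_expr qn.
    exists N; have := hN N (leqnn N); rewrite /= sub0r normrN ger0_norm ?exprn_ge0//.
    move=> h; rewrite (@le_trans _ _ (q ^+ N * (K + 1)))//.
      by rewrite ler_wpM2l ?exprn_ge0// lerDl.
    by rewrite -ler_pdivlMr.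
  have [l hl] : exists l, forall e, 0 < e -> exists N, forall n, (N <= n)%N -> hnorm (u n - l) <= e.
    apply: complete_hnorm => e e0.
    have [N hN] := qe _ (divr_gt0 e0 (ltr0Sn _ 1)).
    have h m : (N <= m)%N -> hnorm (u m - u N) <= e / 2.
      by move=> Nm; rewrite -(subnKC Nm) (le_trans (uq _ _)).
    exists N => m n Nm Nn.
    rewrite (_ : u m - u n = (u m - u N) + (u N - u n)); last by rewrite addrA subrK.
    rewrite (le_trans (ler_hnormD _ _))// [hnorm (u N - _)]hnorm_distC.
    by have := h m Nm; have := h n Nn; lra.
  exists l; apply/eqP; rewrite -subr_eq0; apply/eqP/hnorm_eq0/eqP.
  rewrite eq_le hnorm_ge0 andbT; apply/ler_addgt0Pr => e e0; rewrite add0r.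
  have [N hN] := hl _ (divr_gt0 e0 (ltr0Sn _ 1)).
  rewrite (_ : l - (y + C l) = C (u N - l) - (u N.+1 - l)); last first.
    rewrite linB//= opprB addrCA; congr (_ + _).
    by rewrite (addrC y (C (u N))) [in RHS]opprD addrA (addrAC (C (u N))) subrr add0r -opprD (addrC y).
  rewrite (le_trans (ler_hnormD _ _))// hnorm_opp.
  have := hN N (leqnn _); have := hN N.+1 (leqnSn _); have := hC (u N - l).
  by have := hnorm_ge0 (u N - l); nra.
have [B hB] := choice sol.
have uniq y l : l = y + C l -> l = B y.
  move=> e; apply/eqP; rewrite -subr_eq0; apply/eqP/uniq0.
  by rewrite linB// {1}e {1}hB opprD addrACA subrr add0r.
exists B; split.
- apply/bounded_operatorP; split.
    move=> c x y; symmetry; apply: uniq; rewrite lC {1}hB {1}(hB y).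
    by rewrite scalerDr addrACA.
  exists (1 - q)^-1; first by rewrite invr_ge0 ltW.
  move=> x; rewrite ler_pdivlMl//.
  have := ler_hnormD x (C (B x)); rewrite -hB; have := hC (B x); lra.
- by move=> x; symmetry; apply: uniq; rewrite subrK.
- by move=> x; rewrite {1}hB addrK.
Qed.

Lemma linear_sub A B : linear A -> linear B -> linear (fun x => A x - B x).
Proof. by move=> lA lB a x y; rewrite lA lB scalerBr opprD addrACA. Qed.

Lemma linear_scale (c : R[i]) A : linear A -> linear (fun x => c *: A x).
Proof. by move=> lA a x y; rewrite lA scalerDr !scalerA (mulrC c). Qed.

Lemma invertible_not_spectrum A (l c q : R) : linear A -> c != 0 -> 0 <= q < 1 ->
  opbound (fun x => x - c^-1%:C *: (A x - l%:C *: x)) q -> ~ spectrum A l%:C.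
Proof.
move=> lA c0 q01 hq; apply; set C := fun x => _ in hq.
have lC : linear C.
  apply: linear_sub; first by [].
  by apply: linear_scale; apply: linear_sub => //; exact: linear_scale.
have [B [bB B1 B2]] := neumann lC q01 hq.
have CE x : x - C x = c^-1%:C *: (A x - l%:C *: x) by rewrite /C opprB addrC subrK.
have lB := bounded_operator_linear bB.
have cc : c%:C * c^-1%:C = 1 :> R[i] by rewrite -rmorphM mulfV.
exists (fun x => c^-1%:C *: B x); split.
- have /bounded_operatorP[_ [b b0 hb]] := bB; apply/bounded_operatorP; split.
    by move=> a x y; rewrite lB scalerDr !scalerA [_ * a]mulrC.
  exists (`|c^-1| * b); first exact: mulr_ge0.
  by move=> x; rewrite hnormZr -mulrA ler_wpM2l.
- by move=> x; rewrite -linZ// -CE B1.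
- by move=> x; rewrite linZ// [l%:C *: _]scalerA [_ * c^-1%:C]mulrC -scalerA -scalerBr -CE B2.
Qed.

(** Below [0] and above [M], some real multiple of [A - l] differs from the
    identity by a strict contraction, so that Neumann series invert it. *)
Lemma spectrum_itv A (M l : R) : linear A -> (forall x, 0 <= rip (A x) x) ->
  0 <= M -> opbound A M -> spectrum A l%:C -> 0 <= l <= M.
Proof.
move=> lA pA M0 hM sl; apply/andP; split; rewrite leNgt; apply/negP => hl.
- (* with [tau = s / (M+s)^2], [|x - tau (A+s) x|^2 <= (1 - tau s) |x|^2] *)
  pose s := - l; have s0 : 0 < s by rewrite oppr_gt0.
  have Ms : 0 < M + s by rewrite ltr_wpDl.
  have lE : l = - s by rewrite opprK.
  pose q2 := 1 - s ^+ 2 / (M + s) ^+ 2.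
  have q20 : 0 <= q2.
    rewrite subr_ge0 ler_pdivrMr ?exprn_gt0// mul1r; nra.
  have q21 : q2 < 1 by rewrite ltrBlDr ltrDl divr_gt0 ?exprn_gt0.
  apply: (@invertible_not_spectrum A l ((M + s) ^+ 2 / s) (Num.sqrt q2)) sl => //.
  + by rewrite gt_eqF// divr_gt0// exprn_gt0.
  + by rewrite sqrtr_ge0 /= -sqrtr1 ltr_sqrt.
  move=> x; rewrite lE raddfN scaleNr opprK invf_div.
  set y := A x + _; set tau := s / _.
  rewrite -(ler_pXn2r (n := 2)) ?nnegrE ?mulr_ge0 ?sqrtr_ge0 ?hnorm_ge0//.
  rewrite exprMn sqr_sqrtr// hnorm_sq !(ripBl, ripBr, ripZl, ripZr) (ripC y) -!hnorm_sq.
  have hy : hnorm y <= (M + s) * hnorm x.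
    by rewrite (le_trans (ler_hnormD _ _))// mulrDl hnormZr gtr0_norm// lerD2r.
  have hy2 : hnorm y ^+ 2 <= (M + s) ^+ 2 * hnorm x ^+ 2.
    by rewrite -exprMn ler_pXn2r ?nnegrE ?mulr_ge0 ?hnorm_ge0// ltW.
  have rxy : s * hnorm x ^+ 2 <= rip x y.
    by rewrite /y ripDr ripZr -hnorm_sq lerDr ripC.
  have t0 : 0 < tau by rewrite divr_gt0// exprn_gt0.
  have tE : tau * (M + s) ^+ 2 = s by rewrite /tau divfK// expf_neq0// gt_eqF.
  have -> : q2 = 1 - tau * s by rewrite /q2 /tau; field; rewrite gt_eqF.
  have h1 : tau * (tau * hnorm y ^+ 2) <= tau * (s * hnorm x ^+ 2).
    by rewrite ler_pM2l// -tE -mulrA ler_pM2l.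
  have h2 : tau * (s * hnorm x ^+ 2) <= tau * rip x y by rewrite ler_pM2l.
  by nra.
- have l0 : 0 < l by rewrite (le_lt_trans M0).
  apply: (@invertible_not_spectrum A l (- l) (M / l)) sl => //.
  + by rewrite oppr_eq0 gt_eqF.
  + by rewrite divr_ge0 ?(ltW l0)//= ltr_pdivrMr// mul1r.
  move=> x; rewrite invrN rmorphN scaleNr opprK scalerBr scalerA -rmorphM mulVf ?gt_eqF//.
  rewrite scale1r addrC subrK hnormZr gtr0_norm ?invr_gt0// [M / l]mulrC -mulrA.
  by rewrite ler_wpM2l// invr_ge0 ltW.
Qed.
End Neumann.

(** * Polynomial approximation of power functions *)

Section Bernstein.
Context {R : realType}.
Implicit Types (f : R -> R) (phi psi : nat -> R) (x y t e a b c : R).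

(** The Bernstein polynomial [sum_k phi k * C(n,k) X^k (1-X)^(n-k)], that is, the
    expectation of [phi] at the number of successes in [n] trials of probability
    [X]; conditioning on one trial gives a recursion without binomials. *)
Fixpoint bernstein n phi : {poly R} :=
  if n is n'.+1 then 'X * bernstein n' (phi \o succn) + (1 - 'X) * bernstein n' phi
  else (phi 0)%:P.

Lemma bernsteinS n phi x : (bernstein n.+1 phi).[x] =
  x * (bernstein n (phi \o succn)).[x] + (1 - x) * (bernstein n phi).[x].
Proof. by rewrite /= !hornerE. Qed.

Lemma bernstein_le n phi psi x : 0 <= x <= 1 ->
  (forall k, (k <= n)%N -> phi k <= psi k) ->
  (bernstein n phi).[x] <= (bernstein n psi).[x].
Proof.
move=> /andP[x0 x1]; elim: n phi psi => [|n IH] phi psi h.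
  by rewrite !hornerE h.
rewrite !bernsteinS lerD// ler_wpM2l ?subr_ge0//.
  by apply: IH => k kn; exact: h.
by apply: IH => k kn; apply: h; rewrite (leq_trans kn).
Qed.

(** For [a = 0], [b = 1]: the bias-variance formula of the binomial law. *)
Lemma bernstein_square n a b c x :
  (bernstein n (fun k => a + b * (k%:R - c) ^+ 2)).[x] =
  a + b * ((n%:R * x - c) ^+ 2 + n%:R * (x * (1 - x))).
Proof.
elim: n c => [|n IH] c; first by rewrite !hornerE; ring.
rewrite bernsteinS IH.
rewrite (_ : _ \o _ = (fun k => a + b * (k%:R - (c - 1)) ^+ 2)); last first.
  by apply/funext => k /=; rewrite -natr1; ring.
have -> : n.+1%:R = n%:R + 1 :> R by rewrite -natr1.
by rewrite IH; ring.
Qed.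

(** The hypothesis is uniform continuity of a bounded function, in the form in
    which the variance of the binomial law can be inserted. *)
Lemma bernstein_approx f :
  (forall e, 0 < e -> exists2 C : R, 0 <= C & forall x y, 0 <= x <= 1 -> 0 <= y <= 1 ->
     `|f x - f y| <= e + C * (x - y) ^+ 2) ->
  forall e, 0 < e -> exists p : {poly R}, forall x, 0 <= x <= 1 -> `|f x - p.[x]| <= e.
Proof.
move=> hf e e0; have e20 : 0 < e / 2 by rewrite divr_gt0.
have [C C0 hC] := hf _ e20.
have [n hn] : exists n, C / n.+1%:R <= e / 2.
  have C1 : 0 < C + 1 by rewrite ltr_wpDl.
  have [n hn] := ltr_add_invr (y := 0) (x := e / 2 / (C + 1)) (divr_gt0 e20 C1).
  exists n; rewrite add0r ltr_pdivlMr// in hn; rewrite (le_trans _ (ltW hn))//.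
  by rewrite mulrC ler_wpM2l ?invr_ge0// lerDl.
pose N : R := n.+1%:R; have N0 : 0 < N by rewrite ltr0n.
exists (bernstein n.+1 (fun k => f (k%:R / N))) => x x01.
have hk k : (k <= n.+1)%N -> 0 <= k%:R / N <= 1.
  by move=> kn; rewrite divr_ge0 ?(ltW N0)//= ler_pdivrMr// mul1r ler_nat.
have vE : C / N ^+ 2 * ((N * x - N * x) ^+ 2 + N * (x * (1 - x))) <= e / 2.
  have -> : C / N ^+ 2 * ((N * x - N * x) ^+ 2 + N * (x * (1 - x))) = C / N * (x * (1 - x)).
    by field; rewrite gt_eqF.
  have CN : 0 <= C / N by rewrite divr_ge0// ltW.
  rewrite (le_trans _ hn)// -/N -[leRHS]mulr1 ler_wpM2l//.
  by case/andP: x01; nra.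
have key k : (k <= n.+1)%N -> `|f x - f (k%:R / N)| <= e / 2 + C / N ^+ 2 * (k%:R - N * x) ^+ 2.
  move=> kn; rewrite (le_trans (hC _ _ x01 (hk k kn)))// lerD2l.
  by rewrite le_eqVlt; apply/orP; left; apply/eqP; field; rewrite gt_eqF.
rewrite ler_norml; apply/andP; split.
- have := @bernstein_le n.+1 (fun k => f (k%:R / N))
    (fun k => (f x + e / 2) + C / N ^+ 2 * (k%:R - N * x) ^+ 2) x x01.
  rewrite bernstein_square -/N => h.
  have /h : forall k, (k <= n.+1)%N -> f (k%:R / N) <= f x + e / 2 + C / N ^+ 2 * (k%:R - N * x) ^+ 2.
    by move=> k /key; rewrite ler_norml; move: (C / N ^+ 2 * _) => D /andP[h1 h2]; lra.
  by move: vE; move: (C / N ^+ 2 * _) => D; lra.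
- have := @bernstein_le n.+1 (fun k => (f x - e / 2) + (- (C / N ^+ 2)) * (k%:R - N * x) ^+ 2)
    (fun k => f (k%:R / N)) x x01.
  rewrite bernstein_square -/N => h.
  have /h : forall k, (k <= n.+1)%N -> f x - e / 2 + (- (C / N ^+ 2)) * (k%:R - N * x) ^+ 2 <= f (k%:R / N).
    by move=> k /key; rewrite ler_norml mulNr; move: (C / N ^+ 2 * _) => D /andP[h1 h2]; lra.
  by rewrite mulNr; move: vE; move: (C / N ^+ 2 * _) => D; lra.
Qed.

(** Since [u^t >= u] for [u] in [[0,1]], both summands [x] and [y] satisfy
    [(x+y)^t * (x/(x+y)) <= x^t]. *)
Lemma powR_subadditive t x y : 0 < t <= 1 -> 0 <= x -> 0 <= y ->
  (x + y) `^ t <= x `^ t + y `^ t.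
Proof.
move=> /andP[t0 t1] x0 y0; have [s0|s0] := eqVneq (x + y) 0.
  by rewrite s0 powR0 ?gt_eqF// addr_ge0 ?powR_ge0.
have sp : 0 < x + y by rewrite lt_neqAle eq_sym s0 addr_ge0.
have key u : 0 <= u -> u <= x + y -> (x + y) `^ t * (u / (x + y)) <= u `^ t.
  move=> u0 us; have [->|un] := eqVneq u 0; first by rewrite mul0r mulr0 powR_ge0.
  have up : 0 < u by rewrite lt_neqAle eq_sym un.
  rewrite -{2}(divfK s0 u) [_ / _ * _]mulrC powRM ?divr_ge0 ?(ltW sp)//.
  rewrite ler_wpM2l ?powR_ge0// ger1_powR// divr_gt0//=.
  by rewrite ler_pdivrMr// mul1r.
have := key x x0 ltac:(by rewrite lerDl); have := key y y0 ltac:(by rewrite lerDr).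
have sE : (x + y) `^ t * (x / (x + y)) + (x + y) `^ t * (y / (x + y)) = (x + y) `^ t.
  by field.
by move=> hy hx; rewrite -sE lerD.
Qed.

Lemma powR_holder t x y : 0 < t <= 1 -> 0 <= x -> 0 <= y ->
  `|x `^ t - y `^ t| <= `|x - y| `^ t.
Proof.
move=> t01; wlog xy : x y / y <= x.
  move=> h x0 y0; have [yx|xy] := leP y x; first exact: h.
  by rewrite distrC (distrC x) h// ltW.
move=> x0 y0; have /andP[t0 _] := t01.
rewrite !ger0_norm ?subr_ge0//; last by rewrite ge0_ler_powR ?nnegrE// ltW.
by rewrite lerBlDr (le_trans _ (powR_subadditive _ _ _))// ?subr_ge0// subrK.
Qed.

Lemma powR_poly_approx01 t : 0 <= t <= 1 -> forall e, 0 < e ->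
  exists p : {poly R}, forall x, 0 <= x <= 1 -> `|x `^ t - p.[x]| <= e.
Proof.
move=> /andP[]; rewrite le_eqVlt => /predU1P[<- _ e e0|t0 t1].
  by exists 1%:P => x _; rewrite powRr0 hornerC subrr normr0 ltW.
apply: bernstein_approx => e e0.
(* within [del] use the Hoelder bound [del^t = e]; beyond it, the values differ
   by at most [1 <= (x-y)^2 / del^2] *)
pose del := e `^ t^-1; have d0 : 0 < del by rewrite powR_gt0.
exists (del ^- 2); first by rewrite invr_ge0 sqr_ge0.
move=> x y /andP[x0 x1] /andP[y0 y1].
have [xy|xy] := leP `|x - y| del.
  rewrite (le_trans (powR_holder _ _ _)) ?t0//.
  have : `|x - y| `^ t <= del `^ t by rewrite ge0_ler_powR ?nnegrE ?(ltW t0) ?(ltW d0).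
  rewrite /del -powRrM mulVf ?gt_eqF// powRr1 ?(ltW e0)// => h.
  by rewrite (le_trans h)// lerDl mulr_ge0 ?invr_ge0 ?sqr_ge0.
have h1 : `|x `^ t - y `^ t| <= 1.
  have p1 z : 0 <= z -> z <= 1 -> z `^ t <= 1.
    move=> z0 z1; have := @ge0_ler_powR R t (ltW t0) z 1.
    by rewrite powR1; apply; rewrite ?nnegrE.
  have := p1 x x0 x1; have := p1 y y0 y1.
  have := powR_ge0 x t; have := powR_ge0 y t.
  by rewrite ler_norml; lra.
rewrite (le_trans h1)// ler_wpDl ?(ltW e0)// ler_pdivlMl ?exprn_gt0// mulr1.
by rewrite -[leRHS](ger0_norm (sqr_ge0 _)) normrX ler_pXn2r ?nnegrE ?(ltW d0) ?(ltW xy).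
Qed.

Lemma powR_poly_approx t M : 0 <= t <= 1 -> forall e, 0 < e ->
  exists p : {poly R}, forall x, 0 <= x <= M -> `|x `^ t - p.[x]| <= e.
Proof.
move=> t01 e e0; pose K := `|M| + 1.
have K0 : 0 < K by rewrite ltr_wpDl.
have Kt : 0 < K `^ t by rewrite powR_gt0.
have [p hp] := powR_poly_approx01 t01 (divr_gt0 e0 Kt).
exists (K `^ t *: (p \Po (K^-1 *: 'X))) => x /andP[x0 xM].
have xK : 0 <= x / K <= 1.
  rewrite divr_ge0 ?(ltW K0)//= ler_pdivrMr// mul1r ltW// (le_lt_trans xM)//.
  by rewrite (le_lt_trans (ler_norm _))// ltrDl.
rewrite hornerZ horner_comp hornerZ hornerX [K^-1 * x]mulrC.
have xE : x = K * (x / K) by rewrite mulrC divfK ?gt_eqF.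
have /andP[u0 _] := xK; have := hp _ xK; move: (x / K) u0 xE => u u0 ->.
rewrite powRM ?(ltW K0)// -mulrBr normrM (gtr0_norm Kt) => h.
by rewrite mulrC -ler_pdivlMr.
Qed.
End Bernstein.

(** * The continuous functional calculus *)

Section Cfc.
Context {R : realType} {H : hilbertType R}.
Implicit Types (x y z : H) (A B C : H -> H) (f g : R -> R) (a e m : R).

Definition cfc_approx A f B e (p : {poly R}) :=
  (forall a, spectrum A a%:C -> `|f a - p.[a]| <= e) /\
  (forall x, hnorm (poly_op p A x - B x) <= e * hnorm x).

(** One polynomial for each precision replaces the convergent sequence; all later
    arguments use this form. *)
Lemma is_cfcP A f B : is_cfc A f B <-> forall e, 0 < e -> exists p, cfc_approx A f B e p.
Proof.
split.
  move=> [p [pf pB]] e e0.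
  have : nbhs (f : {uniform` [set a : R | spectrum A a%:C] -> R})
      [set h : R -> R | forall a, spectrum A a%:C -> `|f a - h a| <= e].
    apply/uniform_nbhs; exists [set xy : R * R | ball xy.1 e xy.2].
    split; first exact: entourage_ball (PosNum e0).
    by move=> h /= hh a sa; rewrite ltW//; exact: hh.
  move=> /pf [N1 _ h1]; have [N2 _ h2] := pB e e0.
  exists (p (maxn N1 N2)); split; first exact: (h1 _ (leq_maxl _ _)).
  exact: (h2 _ (leq_maxr _ _)).
move=> h.
have n0 n : 0 < n.+1%:R^-1 :> R by rewrite invr_gt0.
have [p hp] := choice (fun n => h _ (n0 n)).
have small e : 0 < e -> exists N, forall n, (N <= n)%N -> n.+1%:R^-1 < e.
  move=> e0; have [N hN] := ltr_add_invr (y := 0) (x := e) e0.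
  exists N => n Nn; rewrite add0r in hN; rewrite (le_lt_trans _ hN)//.
  by rewrite lef_pV2 ?posrE// ler_nat.
exists p; split.
  move=> U /uniform_nbhs[E [+ EU]]; rewrite -entourage_ballE => -[e e0 eE].
  have [N hN] := small e e0; exists N => // n Nn; apply: EU => a sa; apply: eE => /=.
  by rewrite /ball/= (le_lt_trans ((hp n).1 a sa))// hN.
move=> e e0; have [N hN] := small e e0; exists N => // n Nn x.
by rewrite (le_trans ((hp n).2 x))// ler_wpM2r ?hnorm_ge0// ltW// hN.
Qed.

Section OneOperator.
Variable A : H -> H.
Hypotheses (bA : bounded_operator A) (sA : symmetric_op A).
Let lA := bounded_operator_linear bA.

Lemma is_cfc_le f B m : 0 <= m -> is_cfc A f B ->
  (forall a, spectrum A a%:C -> `|f a| <= m) -> opbound B m.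
Proof.
move=> m0 /is_cfcP fB hm x; apply/ler_addgt0Pr => e e0.
have K0 : 0 < 2 * (hnorm x + 1) by rewrite mulr_gt0// ltr_wpDl ?hnorm_ge0.
have [p [pf pB]] := fB _ (divr_gt0 e0 K0); set del := e / _ in pf pB.
have d0 : 0 < del by rewrite divr_gt0.
have h1 : hnorm (poly_op p A x) <= (m + del) * hnorm x.
  apply: poly_op_spectral_bound => //; first by rewrite addr_ge0// ltW.
  move=> a sa; rewrite -[p.[a]](subKr (f a)) (le_trans (ler_normB _ _))// lerD//.
    exact: hm.
  exact: pf.
have := ler_hnormD (poly_op p A x) (B x - poly_op p A x).
rewrite addrC subrK hnorm_distC => h2.
have h3 := pB x.
have h4 : del * (2 * (hnorm x + 1)) = e by rewrite divfK// gt_eqF.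
by have := hnorm_ge0 x; nra.
Qed.

Lemma is_cfc_ext f g B : (forall a, spectrum A a%:C -> f a = g a) ->
  is_cfc A f B -> is_cfc A g B.
Proof.
move=> fg /is_cfcP fB; apply/is_cfcP => e e0; have [p [pf pB]] := fB e e0.
by exists p; split=> // a sa; rewrite -fg// pf.
Qed.

Lemma is_cfc_sub f g B C : is_cfc A f B -> is_cfc A g C ->
  is_cfc A (fun a => f a - g a) (fun x => B x - C x).
Proof.
move=> /is_cfcP fB /is_cfcP gC; apply/is_cfcP => e e0.
have e2 : 0 < e / 2 by rewrite divr_gt0.
have [p [pf pB]] := fB _ e2; have [q [qg qC]] := gC _ e2.
exists (p - q); split=> [a sa|x].
  rewrite hornerD hornerN opprD addrACA -opprD (le_trans (ler_normB _ _))//.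
  by have := pf a sa; have := qg a sa; lra.
rewrite poly_opB// opprD addrACA -opprD (le_trans (ler_hnormD _ _))// hnorm_opp.
by have := pB x; have := qC x; lra.
Qed.

(** The difference of two values of [f(A)] is a value of [0(A)], of norm [0]. *)
Lemma is_cfc_unique f B C : is_cfc A f B -> is_cfc A f C -> B = C.
Proof.
move=> fB fC; apply/funext => x; apply/eqP; rewrite -subr_eq0; apply/eqP/hnorm_eq0.
have h : opbound (fun x => B x - C x) 0.
  apply: (is_cfc_le (lexx 0) (is_cfc_sub fB fC)) => a _.
  by rewrite subrr normr0.
by apply/eqP; rewrite eq_le hnorm_ge0 andbT (le_trans (h x))// mul0r.
Qed.

Lemma is_cfc_poly (p : {poly R}) : is_cfc A (fun a => p.[a]) (poly_op p A).
Proof.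
apply/is_cfcP => e e0; exists p; split=> [a _|x].
  by rewrite subrr normr0 ltW.
by rewrite subrr hnorm0 mulr_ge0 ?hnorm_ge0// ltW.
Qed.

(** Linearity, like symmetry, passes from the polynomials to their norm limit. *)
Lemma is_cfc_linear f B : is_cfc A f B -> linear B.
Proof.
move=> /is_cfcP fB c x y; apply/eqP; rewrite -subr_eq0; apply/eqP/hnorm_eq0/eqP.
rewrite eq_le hnorm_ge0 andbT; apply/ler_addgt0Pr => e e0; rewrite add0r.
pose K := hnorm (c *: x + y) + complex.Re `|c| * hnorm x + hnorm y.
have c0 : 0 <= complex.Re `|c| by rewrite -lecR RRe_real ?normr_real//; exact: normr_ge0.
have K0 : 0 <= K by rewrite !addr_ge0 ?mulr_ge0 ?hnorm_ge0.
have K1 : 0 < K + 1 by rewrite ltr_wpDl.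
have [p [_ pB]] := fB _ (divr_gt0 e0 K1); set del := e / _ in pB.
have d0 : 0 < del by rewrite divr_gt0.
have -> : B (c *: x + y) - (c *: B x + B y) =
  - (poly_op p A (c *: x + y) - B (c *: x + y)) +
  (c *: (poly_op p A x - B x) + (poly_op p A y - B y)).
  rewrite poly_op_linear// scalerBr opprB.
  by rewrite [(_ - _) + (_ - _) in RHS]addrACA -opprD addrA subrK.
rewrite (le_trans (ler_hnormD _ _))// hnorm_opp.
have := ler_hnormD (c *: (poly_op p A x - B x)) (poly_op p A y - B y).
rewrite hnormZ => h.
have h1 := pB (c *: x + y); have h2 := ler_wpM2l c0 (pB x); have h3 := pB y.
have h4 : del * (K + 1) = e by rewrite divfK// gt_eqF.
rewrite /K in h4; nra.
Qed.

Lemma is_cfc_symmetric f B : is_cfc A f B -> symmetric_op B.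
Proof.
move=> /is_cfcP fB x y; apply/eqP; rewrite -subr_eq0 -normr_eq0 eq_le normr_ge0 andbT.
apply/ler_addgt0Pr => e e0; rewrite add0r.
pose K := hnorm x * hnorm y.
have K0 : 0 <= K by rewrite mulr_ge0 ?hnorm_ge0.
have K1 : 0 < 2 * (K + 1) by rewrite mulr_gt0// ltr_wpDl.
have [p [_ pB]] := fB _ (divr_gt0 e0 K1); set del := e / _ in pB.
have d0 : 0 < del by rewrite divr_gt0.
have -> : rip (B x) y - rip x (B y) =
    rip x (poly_op p A y - B y) - rip (poly_op p A x - B x) y.
  by rewrite ripBl ripBr (poly_op_symmetric lA p sA); ring.
rewrite (le_trans (ler_normB _ _))//.
have h1 := rip_norm x (poly_op p A y - B y).
have h2 := rip_norm (poly_op p A x - B x) y.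
have h3 := ler_wpM2l (hnorm_ge0 x) (pB y).
have h4 := ler_wpM2r (hnorm_ge0 y) (pB x).
have h5 : del * (2 * (K + 1)) = e by rewrite divfK// gt_eqF.
rewrite /K in h5; nra.
Qed.

Lemma is_cfc_comp f g B C m : is_cfc A f B -> is_cfc A g C ->
  (forall a, spectrum A a%:C -> `|f a| <= m) ->
  (forall a, spectrum A a%:C -> `|g a| <= m) ->
  is_cfc A (fun a => f a * g a) (B \o C).
Proof.
wlog m0 : m / 0 <= m.
  move=> h fB gC fm gm; apply: (h `|m|) => // a sa.
    by rewrite (le_trans (fm a sa))// ler_norm.
  by rewrite (le_trans (gm a sa))// ler_norm.
move=> fB gC fm gm.
have hC := is_cfc_le m0 gC gm.
move/is_cfcP: fB => fB; move/is_cfcP: gC => gC.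
apply/is_cfcP => e e0.
pose del := Num.min 1 (e / (2 * m + 1)).
have m1 : 0 < 2 * m + 1 by rewrite ltr_wpDl// mulr_ge0.
have d0 : 0 < del by rewrite lt_min ltr01 divr_gt0.
have d1 : del <= 1 by rewrite ge_min lexx.
have de : (2 * m + del) * del <= e.
  have : del <= e / (2 * m + 1) by rewrite ge_min lexx orbT.
  rewrite ler_pdivlMr// => h; nra.
have [p [pf pB]] := fB _ d0; have [q [qg qC]] := gC _ d0.
exists (p * q); split=> [a sa|x].
  rewrite hornerM.
  have -> : f a * g a - p.[a] * q.[a] =
    f a * (g a - q.[a]) + (f a - p.[a]) * (g a - (g a - q.[a])) by ring.
  rewrite (le_trans (ler_normD _ _))// !normrM.
  have h1 := pf a sa; have h2 := qg a sa.
  have h3 : `|g a - (g a - q.[a])| <= m + del.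
    by rewrite (le_trans (ler_normB _ _))// lerD// gm.
  have h4 : `|f a| * `|g a - q.[a]| <= m * del by rewrite ler_pM// fm.
  have h5 : `|f a - p.[a]| * `|g a - (g a - q.[a])| <= del * (m + del) by rewrite ler_pM.
  by rewrite (le_trans (lerD h4 h5))//; lra.
rewrite poly_opM//=.
have hp y : hnorm (poly_op p A y) <= (m + del) * hnorm y.
  apply: poly_op_spectral_bound => //; first by rewrite addr_ge0// ltW.
  move=> a sa; rewrite -[p.[a]](subKr (f a)) (le_trans (ler_normB _ _))// lerD//.
    exact: fm.
  exact: pf.
have -> : poly_op p A (poly_op q A x) - B (C x) =
  poly_op p A (poly_op q A x - C x) + (poly_op p A (C x) - B (C x)).
  by rewrite (linB (poly_op_linear lA p)) addrA subrK.
rewrite (le_trans (ler_hnormD _ _))//.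
have h1 := hp (poly_op q A x - C x); have h2 := pB (C x).
have h3 : (m + del) * hnorm (poly_op q A x - C x) <= (m + del) * (del * hnorm x).
  by rewrite ler_wpM2l// addr_ge0// ltW.
have h4 : del * hnorm (C x) <= del * (m * hnorm x) by rewrite ler_wpM2l// ltW.
have h5 : (2 * m + del) * del * hnorm x <= e * hnorm x.
  by rewrite ler_wpM2r ?hnorm_ge0.
lra.
Qed.

(** By [poly_op_spectral_bound], polynomials converging uniformly on the spectrum
    give operators that are Cauchy in norm; [H] being complete, they converge
    pointwise, hence in norm. *)
Lemma cfc_exists f :
  (forall e, 0 < e -> exists p : {poly R}, forall a, spectrum A a%:C -> `|f a - p.[a]| <= e) ->
  is_cfc A f (cfc A f).
Proof.
move=> fp.
suff [B fB] : exists B, is_cfc A f B by apply: xgetPex; exists B.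
have n0 n : 0 < n.+1%:R^-1 :> R by rewrite invr_gt0.
have [p hp] := choice (fun n => fp _ (n0 n)).
have small e : 0 < e -> exists N, forall n, (N <= n)%N -> n.+1%:R^-1 <= e.
  move=> e0; have [N hN] := ltr_add_invr (y := 0) (x := e) e0.
  exists N => n Nn; rewrite add0r in hN; rewrite (le_trans _ (ltW hN))//.
  by rewrite lef_pV2 ?posrE// ler_nat.
have pp n k x : hnorm (poly_op (p n) A x - poly_op (p k) A x) <=
    (n.+1%:R^-1 + k.+1%:R^-1) * hnorm x.
  rewrite -poly_opB//; apply: poly_op_spectral_bound => //.
  move=> a sa; rewrite hornerD hornerN.
  have -> : (p n).[a] - (p k).[a] = (f a - (p k).[a]) - (f a - (p n).[a]) by ring.
  by rewrite (le_trans (ler_normB _ _))// addrC lerD// hp.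
have lim x : exists l, forall e, 0 < e -> exists N, forall n, (N <= n)%N ->
    hnorm (poly_op (p n) A x - l) <= e.
  apply: complete_hnorm => e e0.
  have K0 : 0 < 2 * (hnorm x + 1) by rewrite mulr_gt0// ltr_wpDl ?hnorm_ge0.
  have [N hN] := small _ (divr_gt0 e0 K0); set del := e / _ in hN.
  have h5 : del * (2 * (hnorm x + 1)) = e by rewrite divfK// gt_eqF.
  have d0 : 0 < del by rewrite divr_gt0.
  exists N => j k Nj Nk; rewrite (le_trans (pp _ _ _))//.
  rewrite (@le_trans _ _ ((del + del) * hnorm x))//.
    by rewrite ler_wpM2r ?hnorm_ge0// lerD// hN.
  by nra.
have [B hB] := choice lim; exists B; apply/is_cfcP => e e0.
have [N hN] := small _ (divr_gt0 e0 (ltr0Sn R 1)).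
exists (p N); split=> [a sa|x].
  by rewrite (le_trans (hp N a sa))// (le_trans (hN N _))// ler_pdivrMr// ler_pMr// ler1n.
apply/ler_addgt0Pr => d d0; have [N' hN'] := hB x d d0.
pose k := maxn N N'.
have h1 := pp N k x; have h2 := hN' k (leq_maxr _ _).
have h3 := hN N (leqnn _); have h4 := hN k (leq_maxl _ _).
have -> : poly_op (p N) A x - B x =
  (poly_op (p N) A x - poly_op (p k) A x) + (poly_op (p k) A x - B x).
  by rewrite addrA subrK.
rewrite (le_trans (ler_hnormD _ _))// lerD// (le_trans h1)//.
by rewrite ler_wpM2r ?hnorm_ge0// [leRHS]splitr lerD.
Qed.
End OneOperator.
End Cfc.

(** * Powers of positive operators *)

Section Powers.
Context {R : realType} {H : hilbertType R}.
Implicit Types (x y z : H) (a e m s t : R).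

Definition positive_op (A : H -> H) :=
  [/\ bounded_operator A, symmetric_op A & forall x, 0 <= rip (A x) x].

(** For nonnegative exponents the power law also holds at the base [0], because
    [0^0 = 1]; hence the powers of a positive operator form a semigroup even when
    it is not invertible. *)
Lemma powRD_ge0 a s t : 0 <= s -> 0 <= t -> a `^ (s + t) = a `^ s * a `^ t.
Proof.
move=> s0 t0; have [st|st] := eqVneq (s + t) 0; last by rewrite powRD// (negbTE st).
move/eqP: st; rewrite paddr_eq0// => /andP[/eqP -> /eqP ->].
by rewrite addr0 !powRr0 mulr1.
Qed.

Lemma powR_le_add1 a m t : 0 <= t <= 1 -> 0 <= a <= m -> a `^ t <= 1 + m.
Proof.
move=> /andP[t0 t1] /andP[a0 am]; have [a1|a1] := leP a 1.
  have := @ge0_ler_powR R t t0 a 1; rewrite powR1 => h.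
  rewrite (le_trans (h _ _ a1))// ?nnegrE//.
  by rewrite lerDl (le_trans a0).
by rewrite (le_trans (ler1_powR (ltW a1) t1))// (le_trans am)// lerDr.
Qed.

Section Positive.
Variable A : H -> H.
Hypothesis pA : positive_op A.
Let bA : bounded_operator A. Proof. by case: pA. Qed.
Let sA : symmetric_op A. Proof. by case: pA. Qed.
Let lA := bounded_operator_linear bA.

Lemma positive_spectrum : exists2 M : R, 0 <= M & forall a, spectrum A a%:C -> 0 <= a <= M.
Proof.
case: pA => _ _ pA0; have /bounded_operatorP[_ [M M0 hM]] := bA.
by exists M => // a; exact: spectrum_itv.
Qed.

Lemma pow_opP t : 0 <= t <= 1 -> is_cfc A (fun a => a `^ t) (pow_op A t).
Proof.
move=> t01; have [M M0 hM] := positive_spectrum.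
apply: cfc_exists => // e e0; have [p hp] := powR_poly_approx M t01 e0.
by exists p => a sa; apply/hp/hM.
Qed.

(** Uniformity in [t] is what gives the boundedness required by
    [midpoint_interpolation]. *)
Lemma pow_op_uniform_bound : exists2 K : R, 0 <= K & forall t, 0 <= t <= 1 -> opbound (pow_op A t) K.
Proof.
have [M M0 hM] := positive_spectrum; have K0 : 0 <= 1 + M by rewrite addr_ge0.
exists (1 + M) => // t t01; apply: (is_cfc_le bA sA K0 (pow_opP t01)) => a sa.
by rewrite ger0_norm ?powR_ge0// powR_le_add1// hM.
Qed.

Lemma pow_op_bounded t : 0 <= t <= 1 -> bounded_operator (pow_op A t).
Proof.
move=> t01; apply/bounded_operatorP; split; first exact: is_cfc_linear (pow_opP t01).
by have [K K0 hK] := pow_op_uniform_bound; exists K => //; exact: hK.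
Qed.

Lemma pow_op_symmetric t : 0 <= t <= 1 -> symmetric_op (pow_op A t).
Proof. by move=> t01; exact: is_cfc_symmetric (pow_opP t01). Qed.

Lemma pow_opD s t x : 0 <= s -> 0 <= t -> s + t <= 1 ->
  pow_op A (s + t) x = pow_op A s (pow_op A t x).
Proof.
move=> s0 t0 st; have [M M0 hM] := positive_spectrum.
have s01 : 0 <= s <= 1 by rewrite s0 (le_trans _ st)// lerDl.
have t01 : 0 <= t <= 1 by rewrite t0 (le_trans _ st)// lerDr.
have st01 : 0 <= s + t <= 1 by rewrite addr_ge0.
have h r : 0 <= r <= 1 -> forall a, spectrum A a%:C -> `|a `^ r| <= 1 + M.
  by move=> r01 a sa; rewrite ger0_norm ?powR_ge0// powR_le_add1// hM.
have hc := is_cfc_comp bA sA (pow_opP s01) (pow_opP t01) (h s s01) (h t t01).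
have /is_cfc_unique : is_cfc A (fun a => a `^ (s + t)) (pow_op A s \o pow_op A t).
  by apply: (is_cfc_ext _ hc) => a _; rewrite powRD_ge0.
by move=> /(_ bA sA _ (pow_opP st01)) <-.
Qed.

Lemma pow_op0 x : pow_op A 0 x = x.
Proof.
have h : is_cfc A (fun a => a `^ 0) (poly_op 1%:P A).
  apply: (is_cfc_ext _ (is_cfc_poly A 1%:P)) => a _.
  by rewrite hornerC powRr0.
have h0 : (0 : R) <= 0 <= (1 : R) by lra.
by rewrite (is_cfc_unique bA sA (pow_opP h0) h) poly_opC scale1r.
Qed.

Lemma pow_op1 x : pow_op A 1 x = A x.
Proof.
have [M M0 hM] := positive_spectrum.
have h : is_cfc A (fun a => a `^ 1) (poly_op 'X A).
  apply: (is_cfc_ext _ (is_cfc_poly A 'X)) => a /hM/andP[a0 _].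
  by rewrite hornerX powRr1.
have h0 : (0 : R) <= 1 <= (1 : R) by lra.
by rewrite (is_cfc_unique bA sA (pow_opP h0) h) poly_opX.
Qed.

Lemma sqrt_opE : sqrt_op A = pow_op A 2^-1.
Proof.
have [M M0 hM] := positive_spectrum.
have h0 : (0 : R) <= 2^-1 <= (1 : R) by lra.
have h : is_cfc A Num.sqrt (pow_op A 2^-1).
  apply: (is_cfc_ext _ (pow_opP h0)) => a /hM/andP[a0 _].
  by rewrite powR12_sqrt.
have : is_cfc A Num.sqrt (sqrt_op A) by apply: xgetPex; exists (pow_op A 2^-1).
by move=> h'; exact: (is_cfc_unique bA sA h' h).
Qed.

Lemma pow_op_positive t : 0 <= t <= 1 -> positive_op (pow_op A t).
Proof.
move=> /andP[t0 t1]; have t20 : 0 <= t / 2 by rewrite divr_ge0.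
have t2 : 0 <= t / 2 <= 1 by rewrite t20 /=; lra.
split=> [||x]; [apply: pow_op_bounded|apply: pow_op_symmetric|]; rewrite ?t0//.
rewrite [X in pow_op A X](splitr t) pow_opD// -?splitr//.
by rewrite pow_op_symmetric// -hnorm_sq sqr_ge0.
Qed.

Lemma sqrt_op_positive : positive_op (sqrt_op A).
Proof. by rewrite sqrt_opE; apply: pow_op_positive; lra. Qed.

Lemma sqrt_op_sq x : sqrt_op A (sqrt_op A x) = A x.
Proof.
have h : 2^-1 + 2^-1 = 1 :> R by rewrite -[2^-1]mul1r -splitr.
by rewrite sqrt_opE -pow_opD ?invr_ge0// h ?pow_op1.
Qed.
End Positive.

Lemma ripZ_conj (c : R[i]) x y : rip (c *: x) y = rip x (Num.conj c *: y).
Proof. by rewrite /rip [in RHS]innerC !innerZl rmorphM /= conjCK -innerC. Qed.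

Lemma gram_positive d (T : 'I_d -> H -> H) :
  (forall k, bounded_operator (T k)) -> positive_op (gram T).
Proof.
move=> bT; have rg := rip_gram bT.
have bS := tsq_le bT.
split.
- apply/bounded_operatorP; split.
    move=> c x y; apply: rip_ext => z.
    rewrite ripDl ripZ_conj !rg -big_split; apply: eq_bigr => k _ /=.
    have lT := bounded_operator_linear (bT k).
    by rewrite lT (linZ lT (Num.conj c)) -ripZ_conj ripDl.
  exists (tuple_norm T ^+ 2); first exact: sqr_ge0.
  move=> x.
  rewrite -(ler_pXn2r (n := 2)) ?nnegrE ?mulr_ge0 ?hnorm_ge0 ?tuple_norm_ge0//.
  rewrite (le_trans (hnorm_gram bT x))// exprMn [(_ ^+ 2) ^+ 2]expr2 -mulrA.
  by rewrite ler_wpM2l ?sqr_ge0// bS.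
- by move=> x y; rewrite rg ripC rg; apply: eq_bigr => k _; rewrite ripC.
- by move=> x; rewrite rip_gram_sq// tsq_ge0.
Qed.
End Powers.

(** * Midpoint log-convexity and means of real numbers *)

Section Scalar.
Context {R : realType}.
Implicit Types (a b t u v : R) (phi : R -> R).

(** Used to let an end value tend to [0] in the interpolation inequality. *)
Lemma powR_vanish (c r u : R) : 0 < c -> 0 < r ->
  (forall v, 0 < v -> u <= c * v `^ r) -> u <= 0.
Proof.
move=> c0 r0 h; rewrite leNgt; apply/negP => u0.
have w0 : 0 < u / (2 * c) by rewrite divr_gt0// mulr_gt0.
have := h ((u / (2 * c)) `^ r^-1); rewrite powR_gt0// => /(_ isT).
rewrite -powRrM mulVf ?gt_eqF// powRr1 ?(ltW w0)//.
have -> : c * (u / (2 * c)) = u / 2 by field; rewrite gt_eqF.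
by lra.
Qed.

Lemma powR_ge_min1 b t : 0 < b -> 0 <= t <= 1 -> Num.min 1 b <= b `^ t.
Proof.
move=> b0 /andP[t0 t1]; rewrite ge_min; have [b1|b1] := leP 1 b.
  by rewrite -[leLHS](powRr0 b) ler_powR.
by rewrite ger1_powR ?orbT// b0 ltW.
Qed.

Section Midpoint.
Variables (phi : R -> R) (C : R).
Hypothesis phi_bound : forall t, 0 <= t <= 1 -> 0 <= phi t <= C.
Hypothesis phi_mid : forall a b, 0 <= b -> b <= a -> a <= 1 ->
  phi ((a + b) / 2) ^+ 2 <= phi a * phi b.

(** Dividing [phi] by the interpolating geometric function gives a midpoint
    log-convex [g], at most [1] at both ends.  Each [t] is the midpoint of [0] and
    [2t], or of [1] and [2t-1], so [g t ^ 2 <= sup g]; hence [sup g <= 1]. *)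
Lemma midpoint_interpolation_pos (al be : R) : 0 < al -> 0 < be ->
  phi 0 <= al -> phi 1 <= be ->
  forall t, 0 <= t <= 1 -> phi t <= be `^ t * al `^ (1 - t).
Proof.
move=> al0 be0 h0 h1; pose w t := be `^ t * al `^ (1 - t).
have w0 t : 0 < w t by rewrite mulr_gt0 ?powR_gt0.
pose g t := phi t / w t.
have g0 t : 0 <= t <= 1 -> 0 <= g t.
  by move=> t01; rewrite divr_ge0 ?(ltW (w0 t))//; case/andP: (phi_bound t01).
have gmid a b : 0 <= b -> b <= a -> a <= 1 -> g ((a + b) / 2) ^+ 2 <= g a * g b.
  move=> b0 ba a1.
  have ww : w ((a + b) / 2) ^+ 2 = w a * w b.
    have e1 : (a + b) / 2 + (a + b) / 2 = a + b by rewrite -splitr.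
    have e2 : (1 - (a + b) / 2) + (1 - (a + b) / 2) = (1 - a) + (1 - b) by rewrite addrACA -opprD e1; ring.
    have D (x r q : R) : 0 < x -> x `^ (r + q) = x `^ r * x `^ q.
      by move=> x0; rewrite powRD// (gt_eqF x0) implybT.
    by rewrite /w expr2 mulrACA -!D// e1 e2 (D be)// (D al (1 - a))// mulrACA.
  rewrite /g mulrACA -invfM -ww exprMn exprVn ler_pM2r ?invr_gt0 ?exprn_gt0//.
  exact: phi_mid.
have gb : exists B, forall t, 0 <= t <= 1 -> g t <= B.
  exists (C / (Num.min 1 be * Num.min 1 al)) => t t01.
  have t01' : 0 <= 1 - t <= 1 by move/andP: t01 => [? ?]; apply/andP; split; lra.
  have m0 b : 0 < b -> 0 < Num.min 1 b by move=> b0; rewrite lt_min ltr01.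
  have /andP[p0 pC] := phi_bound t01.
  rewrite /g ler_pM ?invr_ge0 ?(ltW (w0 t))// lef_pV2 ?posrE ?mulr_gt0 ?m0 ?powR_gt0//.
  by rewrite ler_pM ?(ltW (m0 _ _))// powR_ge_min1.
pose E := [set g t | t in [set t | 0 <= t <= 1]].
have t00 : (0 : R) <= 0 <= (1 : R) by lra.
have supE : has_sup E.
  split; first by exists (g 0), 0.
  by have [B hB] := gb; exists B => _ [t /= t01 <-]; exact: hB.
pose G := sup E.
have gG t : 0 <= t <= 1 -> g t <= G by move=> t01; apply: ub_le_sup; [exact: supE.2|exists t].
have G0 : 0 <= G by rewrite (le_trans (g0 _ t00))// gG.
have g01 : g 0 <= 1.
  by rewrite /g ler_pdivrMr// mul1r /w powRr0 mul1r subr0 powRr1// ltW.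
have g11 : g 1 <= 1.
  by rewrite /g ler_pdivrMr// mul1r /w subrr powRr0 mulr1 powRr1// ltW.
have g2 t : 0 <= t <= 1 -> g t ^+ 2 <= G.
  move=> /andP[t0 t1]; have [t2|t2] := leP t (2^-1).
    have t2' : 0 <= t + t <= 1 by apply/andP; split; lra.
    have := @gmid (t + t) 0 (lexx _); rewrite addr0 mulrDl -splitr => h.
    have {h} := h ltac:(lra) ltac:(lra).
    have := gG _ t2'; have := g0 _ t2'; have := g0 _ t00; nra.
  have t2' : 0 <= t + t - 1 <= 1 by apply/andP; split; lra.
  have t11 : (0 : R) <= 1 <= (1 : R) by lra.
  have := @gmid 1 (t + t - 1); rewrite (_ : (1 + (t + t - 1)) / 2 = t) => [h|]; last by field.
  have {h} := h ltac:(lra) ltac:(lra) (lexx _).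
  have := gG _ t2'; have := g0 _ t2'; have := g0 _ t11; nra.
have GG : G <= Num.sqrt G.
  apply: ge_sup; first exact: supE.1.
  move=> _ [t /= t01 <-]; rewrite -[leLHS](ger0_norm (g0 _ t01)) -sqrtr_sqr.
  by rewrite ler_wsqrtr// g2.
have G1 : G <= 1.
  have : G ^+ 2 <= Num.sqrt G ^+ 2 by rewrite ler_pXn2r ?nnegrE ?sqrtr_ge0.
  by rewrite sqr_sqrtr// => h; rewrite leNgt; apply/negP => G1; nra.
by move=> t t01; have := le_trans (gG t t01) G1; rewrite ler_pdivrMr// mul1r.
Qed.

Lemma midpoint_interpolation t : 0 <= t <= 1 -> phi t <= phi 1 `^ t * phi 0 `^ (1 - t).
Proof.
move=> t01; have /andP[t0 t1] := t01.
have t00 : (0 : R) <= 0 <= (1 : R) by lra.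
have t11 : (0 : R) <= 1 <= (1 : R) by lra.
have /andP[p0 _] := phi_bound t00; have /andP[p1 _] := phi_bound t11.
have [->|tn0] := eqVneq t 0; first by rewrite powRr0 mul1r subr0 powRr1.
have [->|tn1] := eqVneq t 1; first by rewrite subrr powRr0 mulr1 powRr1.
have tp : 0 < t by rewrite lt_neqAle eq_sym tn0.
have rp : 0 < 1 - t by rewrite subr_gt0 lt_neqAle tn1.
have [p0z|p0n] := eqVneq (phi 0) 0.
  rewrite p0z [0 `^ _]powR0 ?gt_eqF// mulr0.
  apply: (@powR_vanish ((phi 1 + 1) `^ t) (1 - t)) => //; first by rewrite powR_gt0// ltr_wpDl.
  move=> v v0; apply: midpoint_interpolation_pos => //; rewrite ?ltr_wpDl//.
    by rewrite p0z ltW.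
  by rewrite lerDl.
have [p1z|p1n] := eqVneq (phi 1) 0.
  rewrite p1z [0 `^ _]powR0 ?gt_eqF// mul0r.
  apply: (@powR_vanish (phi 0 `^ (1 - t)) t) => //; first by rewrite powR_gt0// lt_neqAle eq_sym p0n.
  move=> v v0; rewrite mulrC; apply: midpoint_interpolation_pos => //.
    by rewrite lt_neqAle eq_sym p0n.
  by rewrite p1z ltW.
by apply: midpoint_interpolation_pos => //; rewrite lt_neqAle eq_sym ?p0n ?p1n.
Qed.
End Midpoint.

(** This is [(v^t - u^t) (v^(1-t) - u^(1-t)) >= 0]. *)
Lemma heinz_mean_le u v t : 0 <= u -> u <= v -> 0 <= t <= 1 ->
  u `^ t * v `^ (1 - t) + u `^ (1 - t) * v `^ t <= u + v.
Proof.
move=> u0 uv /andP[t0 t1]; have v0 := le_trans u0 uv.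
have r0 : 0 <= 1 - t by rewrite subr_ge0.
have pE x : 0 <= x -> x = x `^ t * x `^ (1 - t).
  by move=> x0; rewrite -powRD_ge0// addrC subrK powRr1.
rewrite [X in _ <= X + _](pE u)// [X in _ <= _ + X](pE v)//.
have h1 : u `^ t <= v `^ t by rewrite ge0_ler_powR ?nnegrE.
have h2 : u `^ (1 - t) <= v `^ (1 - t) by rewrite ge0_ler_powR ?nnegrE.
by nra.
Qed.
End Scalar.

(** * Norm inequalities for the spherical transforms *)

Section Main.
Context {R : realType} {H : hilbertType R}.
Variable d : nat.
Implicit Types (x y z : H) (a b t : R) (S T V : 'I_d -> H -> H).

Lemma tuple_norm_gt0_unit S : 0 < tuple_norm S -> exists x : H, hnorm x = 1.
Proof.
move=> s0; apply: contrapT => hn; move: s0; rewrite /tuple_norm.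
rewrite [X in sup X](_ : _ = set0) ?sup0 ?ltxx//.
by rewrite -subset0 => _ [x /= x1 _]; apply: hn; exists x.
Qed.

Lemma tuple_norm_mean S T : (forall k, bounded_operator (S k)) ->
  (forall k, bounded_operator (T k)) ->
  tuple_norm (fun k x => 2^-1 *: (S k x + T k x)) <= 2^-1 * (tuple_norm S + tuple_norm T).
Proof.
move=> bS bT; have s0 := tuple_norm_ge0 bS; have t0 := tuple_norm_ge0 bT.
have half : (2^-1 : R)%:C = 2^-1 :> R[i] by rewrite fmorphV rmorph_nat.
apply: tuple_norm_le => [|x]; first by rewrite mulr_ge0 ?addr_ge0 ?invr_ge0.
have -> : tsq (fun k x => 2^-1 *: (S k x + T k x)) x =
    2^-1 ^+ 2 * (tsq S x + tsq T x + 2 * \sum_k rip (S k x) (T k x)).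
  rewrite /tsq -big_split mulr_sumr -big_split mulr_sumr /=; apply: eq_bigr => k _.
  rewrite -half hnormZr exprMn -normrX ger0_norm ?sqr_ge0//; congr (_ * _).
  rewrite !hnorm_sq !(ripDl, ripDr) (ripC (T k x)); ring.
rewrite exprMn -[leRHS]mulrA ler_wpM2l ?sqr_ge0//.
have h1 := tsq_le bS x; have h2 := tsq_le bT x.
have h3 := sum_rip_le (fun k => S k x) (fun k => T k x).
have h4 : Num.sqrt (tsq S x) <= tuple_norm S * hnorm x.
  by rewrite -[leRHS]ger0_norm ?mulr_ge0 ?hnorm_ge0// -sqrtr_sqr ler_wsqrtr// exprMn.
have h5 : Num.sqrt (tsq T x) <= tuple_norm T * hnorm x.
  by rewrite -[leRHS]ger0_norm ?mulr_ge0 ?hnorm_ge0// -sqrtr_sqr ler_wsqrtr// exprMn.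
have h6 := ler_pM (sqrtr_ge0 _) (sqrtr_ge0 _) h4 h5.
have h7 := le_trans h3 h6.
by nra.
Qed.

(** Near-maximisers [x] of the column [S] satisfy [<S*S x, Q^2 x> ~ s^2 |Q x|^2].
    The error is small relative to [|Q x|^2], since [S] factors through [Q] and
    [|S x|] is close to [s], which keeps [Q x] away from [0]. *)
Lemma approx_singular_weighted S (Q : H -> H) (L : R) : (forall k, bounded_operator (S k)) ->
  bounded_operator Q -> symmetric_op Q -> 0 < tuple_norm S ->
  (forall x, tsq S x <= L * hnorm (Q x) ^+ 2) ->
  forall e, 0 < e -> exists2 x, 0 < hnorm (Q x) &
    (tuple_norm S ^+ 2 - e) * hnorm (Q x) ^+ 2 <= rip (gram S x) (Q (Q x)).
Proof.
move=> bS /bounded_operatorP[_ [K K0 hK]] sQ s0 hL e e0.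
set s := tuple_norm S in s0 *.
wlog L0 : L hL / 0 < L.
  move=> /(_ (`|L| + 1)); apply; last by rewrite ltr_wpDl.
  move=> x; rewrite (le_trans (hL x))// ler_wpM2r ?sqr_ge0//.
  by rewrite (le_trans (ler_norm _))// lerDl.
have s20 : 0 < s ^+ 2 by rewrite exprn_gt0.
pose D := 2 * L * (K ^+ 2 + 1).
have D0 : 0 < D by rewrite !mulr_gt0// ltr_wpDl ?sqr_ge0.
pose del := Num.min (s ^+ 2 / 2) (e * s ^+ 2 / D).
have d0 : 0 < del by rewrite lt_min !divr_gt0// mulr_gt0.
have ds : del <= s ^+ 2 / 2 by rewrite ge_min lexx.
have dD : del * D <= e * s ^+ 2 by rewrite -ler_pdivlMr// ge_min lexx orbT.
have [x [x1 hx1 hx2]] := gram_approx_eigen bS (tuple_norm_gt0_unit s0) d0.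
rewrite -/s in hx1 hx2.
have hq : s ^+ 2 <= 2 * L * hnorm (Q x) ^+ 2.
  by have := hL x; move: hx1 ds; nra.
have q2 : 0 < hnorm (Q x) ^+ 2.
  have : 0 < 2 * L * hnorm (Q x) ^+ 2 by exact: lt_le_trans hq.
  by rewrite pmulr_rgt0// mulr_gt0.
exists x; first by rewrite lt_neqAle hnorm_ge0 andbT eq_sym -sqrf_eq0 gt_eqF.
have hQQ : hnorm (Q (Q x)) <= K ^+ 2.
  have := hK (Q x); have := hK x; rewrite x1 mulr1 => h1 h2.
  by rewrite (le_trans h2)// expr2 ler_wpM2l.
have h1 := rip_norm (gram S x - (s ^+ 2)%:C *: x) (Q (Q x)).
have h2 := ler_pM (hnorm_ge0 _) (hnorm_ge0 _) hx2 hQQ.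
have := le_trans h1 h2.
rewrite ler_norml ripBl ripZl -(sQ x (Q x)) -hnorm_sq => /andP[h3 _].
have h4 : del * K ^+ 2 <= e * hnorm (Q x) ^+ 2.
  have h5 : del * D <= e * (2 * L * hnorm (Q x) ^+ 2).
    by rewrite (le_trans dD)// ler_pM2l.
  have h6 : del * (2 * L * (K ^+ 2)) <= del * D.
    by rewrite ler_pM2l// ler_pM2l ?mulr_gt0// lerDl.
  have L20 : 0 < 2 * L by rewrite mulr_gt0.
  rewrite -(ler_pM2l L20).
  by move: (le_trans h6 h5); rewrite mulrCA [e * _]mulrCA.
by move: h3 h4; nra.
Qed.

Section Polar.
Variables (P : H -> H) (V : 'I_d -> H -> H).
Hypothesis pP : positive_op P.
Hypothesis bV : forall k, bounded_operator (V k).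

Lemma gen_aluthge_bounded t : 0 <= t <= 1 -> forall k, bounded_operator (gen_aluthge P V t k).
Proof.
move=> t01 k; have t01' : 0 <= 1 - t <= 1 by move/andP: t01 => [? ?]; apply/andP; split; lra.
exact: (bounded_operator_comp (bounded_operator_comp (pow_op_bounded pP t01) (bV k)) (pow_op_bounded pP t01')).
Qed.

Lemma sandwich_bound : exists2 L : R, 0 <= L & forall s t, 0 <= s <= 1 -> 0 <= t <= 1 ->
  forall x, tsq (fun k => pow_op P s \o V k \o pow_op P t) x <= L ^+ 2 * hnorm x ^+ 2.
Proof.
have [K K0 hK] := pow_op_uniform_bound pP; have [c c0 hc] := tsq_bound bV.
exists (K * c * K); first by rewrite !mulr_ge0.
move=> s t s01 t01 x; set y := pow_op P t x.
rewrite (@le_trans _ _ (K ^+ 2 * tsq V y))//.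
  rewrite /tsq mulr_sumr; apply: ler_sum => k _.
  by rewrite -exprMn ler_pXn2r ?nnegrE ?mulr_ge0 ?hnorm_ge0// hK.
rewrite [leRHS](_ : _ = K ^+ 2 * (c ^+ 2 * (K ^+ 2 * hnorm x ^+ 2))); last by ring.
rewrite ler_wpM2l ?sqr_ge0//.
rewrite (le_trans (hc y))// ler_wpM2l ?sqr_ge0//.
by rewrite -exprMn ler_pXn2r ?nnegrE ?mulr_ge0 ?hnorm_ge0// hK.
Qed.

(** With [S = A_c], [c = (a+b)/2] and [Q = P^((a-b)/2)] one has
    [<S*S x, Q^2 x> = <A_a Q x, A_b Q x>], because
    [P^(1-c) = P^(1-a) Q], [P^(1-c) Q = P^(1-b)], [P^a = Q P^c], [P^c = Q P^b]. *)
Lemma gen_aluthge_midpoint a b : 0 <= b -> b <= a -> a <= 1 ->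
  tuple_norm (gen_aluthge P V ((a + b) / 2)) ^+ 2 <=
  tuple_norm (gen_aluthge P V a) * tuple_norm (gen_aluthge P V b).
Proof.
move=> b0 ba a1; pose c := (a + b) / 2; pose del := (a - b) / 2.
have a01 : 0 <= a <= 1 by apply/andP; split; lra.
have b01 : 0 <= b <= 1 by apply/andP; split; lra.
have c01 : 0 <= c <= 1 by apply/andP; split; rewrite /c; lra.
have c1' : 0 <= 1 - c <= 1 by apply/andP; split; rewrite /c; lra.
have a1' : 0 <= 1 - a <= 1 by apply/andP; split; lra.
have d01 : 0 <= del <= 1 by apply/andP; split; rewrite /del; lra.
have /andP[d0 _] := d01; have /andP[c0 _] := c01; have /andP[c0' _] := c1'.
have /andP[a0' _] := a1'.
have E1 : 1 - c = (1 - a) + del by rewrite /c /del; field.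
have E2 : 1 - b = (1 - c) + del by rewrite /c /del; field.
have E3 : a = del + c by rewrite /c /del; field.
have E4 : c = del + b by rewrite /c /del; field.
have E1' : (1 - a) + del <= 1 by rewrite -E1; case/andP: c1'.
have E2' : (1 - c) + del <= 1 by rewrite -E2; lra.
have E3' : del + c <= 1 by rewrite -E3.
have E4' : del + b <= 1 by rewrite -E4; case/andP: c01.
rewrite -/c; set S := gen_aluthge P V c; set Q := pow_op P del.
have bA := gen_aluthge_bounded a01; have bB := gen_aluthge_bounded b01.
have bS : forall k, bounded_operator (S k) := gen_aluthge_bounded c01.
have sE k x : S k x = pow_op P c (V k (pow_op P (1 - a) (Q x))).
  by rewrite /S /gen_aluthge /= E1 pow_opD.
have [s0|s0] := eqVneq (tuple_norm S) 0.
  by rewrite s0 expr0n /= mulr_ge0 ?tuple_norm_ge0.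
have sp : 0 < tuple_norm S by rewrite lt_neqAle eq_sym s0 tuple_norm_ge0.
have [L L0 hL] := sandwich_bound.
have sQ : forall x, tsq S x <= L ^+ 2 * hnorm (Q x) ^+ 2.
  move=> x; have h := hL c (1 - a) c01 a1' (Q x).
  by apply: le_trans h; rewrite /tsq le_eqVlt; apply/orP; left; apply/eqP/eq_bigr => k _; rewrite sE.
apply/ler_addgt0Pr => e e0; rewrite -lerBlDr.
have [x q0 hx] := approx_singular_weighted bS (pow_op_bounded pP d01) (pow_op_symmetric pP d01) sp sQ e0.
rewrite -/Q in q0 hx.
have q20 : 0 < hnorm (Q x) ^+ 2 by rewrite exprn_gt0.
rewrite -(ler_pM2r q20) (le_trans hx)// rip_gram//.
have -> : \sum_k rip (S k x) (S k (Q (Q x))) =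
    \sum_k rip (gen_aluthge P V a k (Q x)) (gen_aluthge P V b k (Q x)).
  apply: eq_bigr => k _; rewrite sE /S /gen_aluthge /=.
  have -> : pow_op P (1 - c) (Q (Q x)) = pow_op P (1 - b) (Q x).
    by rewrite E2 (pow_opD pP (Q x) c0' d0 E2').
  set u := V k _; set v := V k _.
  rewrite [X in pow_op P X v]E4 pow_opD// -(pow_op_symmetric pP d01).
  by rewrite -pow_opD// -E3.
rewrite (le_trans (sum_rip_le _ _))//.
have h4 : Num.sqrt (tsq (gen_aluthge P V a) (Q x)) <= tuple_norm (gen_aluthge P V a) * hnorm (Q x).
  by rewrite -[leRHS]ger0_norm ?mulr_ge0 ?hnorm_ge0 ?tuple_norm_ge0// -sqrtr_sqr ler_wsqrtr// exprMn tsq_le.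
have h5 : Num.sqrt (tsq (gen_aluthge P V b) (Q x)) <= tuple_norm (gen_aluthge P V b) * hnorm (Q x).
  by rewrite -[leRHS]ger0_norm ?mulr_ge0 ?hnorm_ge0 ?tuple_norm_ge0// -sqrtr_sqr ler_wsqrtr// exprMn tsq_le.
have := ler_pM (sqrtr_ge0 _) (sqrtr_ge0 _) h4 h5.
by rewrite mulrACA -expr2.
Qed.

Lemma heinzC t : heinz P V t = heinz P V (1 - t).
Proof. by apply/funext => k; apply/funext => x; rewrite /heinz subKr addrC. Qed.

Lemma heinz_bounded t : 0 <= t <= 1 -> forall k, bounded_operator (heinz P V t k).
Proof.
move=> t01 k; have t01' : 0 <= 1 - t <= 1 by move/andP: t01 => [? ?]; apply/andP; split; lra.
have /bounded_operatorP[lA [a a0 hA]] := gen_aluthge_bounded t01 k.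
have /bounded_operatorP[lB [b b0 hB]] := gen_aluthge_bounded t01' k.
have half : (2^-1 : R)%:C = 2^-1 :> R[i] by rewrite fmorphV rmorph_nat.
apply/bounded_operatorP; split.
  by apply: linear_scale => c x y; rewrite lA lB scalerDr addrACA.
exists (2^-1 * (a + b)); first by rewrite mulr_ge0 ?addr_ge0 ?invr_ge0.
move=> x; rewrite /heinz -half hnormZr ger0_norm ?invr_ge0// -mulrA ler_wpM2l ?invr_ge0//.
by rewrite (le_trans (ler_hnormD _ _))// mulrDl lerD.
Qed.

(** With [S = A_(1/2)], [Q = P^(t-1/2)] and [M] the Heinz transform,
    [2 <M Q x, Q S x> = |Q S x|^2 + <S*S x, Q^2 x>] for every [x]. *)
Lemma aluthge_le_heinz t : 0 <= t <= 1 ->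
  tuple_norm (aluthge P V) <= tuple_norm (heinz P V t).
Proof.
wlog t2 : t / 2^-1 <= t.
  move=> h t01; have [t2|t2] := leP (2^-1) t; first exact: h.
  by rewrite heinzC; apply: h; move/andP: t01 => [? ?]; [|apply/andP; split]; lra.
move=> t01; have /andP[t0 t1] := t01.
have bM := heinz_bounded t01.
set M := heinz P V t in bM *; set S := aluthge P V.
pose h : R := 2^-1; pose del := t - h.
have hh : 1 - h = h by rewrite /h; lra.
have h01 : 0 <= h <= 1 by apply/andP; split; rewrite /h; lra.
have d01 : 0 <= del <= 1 by apply/andP; split; rewrite /del /h; lra.
have r01 : 0 <= 1 - t <= 1 by apply/andP; split; lra.
have /andP[d0 _] := d01; have /andP[r0 _] := r01; have /andP[h0 h1] := h01.
have E1 : h = (1 - t) + del by rewrite /del /h; lra.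
have E2 : h = del + (1 - t) by rewrite addrC.
have E3 : t = del + h by rewrite subrK.
have E4 : t = h + del by rewrite addrC.
have E1' : (1 - t) + del <= 1 by rewrite -E1.
have E2' : del + (1 - t) <= 1 by rewrite -E2.
have E3' : del + h <= 1 by rewrite -E3.
have E4' : h + del <= 1 by rewrite -E4.
set Q := pow_op P del.
have SE k x : S k x = pow_op P h (V k (pow_op P h x)).
  by rewrite /S /aluthge /gen_aluthge /= -/h hh.
have bS : forall k, bounded_operator (S k) := gen_aluthge_bounded h01.
have [s0|s0] := eqVneq (tuple_norm S) 0; first by rewrite s0 tuple_norm_ge0.
have sp : 0 < tuple_norm S by rewrite lt_neqAle eq_sym s0 tuple_norm_ge0.
have m0 := tuple_norm_ge0 bM.
have [L L0 hL] := sandwich_bound.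
have sQ : forall x, tsq S x <= L ^+ 2 * hnorm (Q x) ^+ 2.
  move=> x; have hx := hL h (1 - t) h01 r01 (Q x).
  apply: le_trans hx; rewrite /tsq le_eqVlt; apply/orP; left; apply/eqP/eq_bigr => k _.
  by rewrite SE [X in V k (pow_op P X _)]E1 pow_opD.
rewrite -(ler_pXn2r (n := 2)) ?nnegrE ?(ltW sp)//.
apply/ler_addgt0Pr => e e0; rewrite -lerBlDr.
have [x q0 hx] := approx_singular_weighted bS (pow_op_bounded pP d01) (pow_op_symmetric pP d01) sp sQ e0.
rewrite -/Q in q0 hx.
have sQQ := pow_op_symmetric pP d01; rewrite -/Q in sQQ.
have q20 : 0 < hnorm (Q x) ^+ 2 by rewrite exprn_gt0.
pose b2 := \sum_k hnorm (Q (S k x)) ^+ 2.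
have b20 : 0 <= b2 by apply: sumr_ge0 => k _; exact: sqr_ge0.
have key : \sum_k rip (M k (Q x)) (Q (S k x)) = 2^-1 * (b2 + rip (gram S x) (Q (Q x))).
  rewrite rip_gram// /b2 -big_split mulr_sumr /=; apply: eq_bigr => k _.
  have half : (2^-1 : R)%:C = 2^-1 :> R[i] by rewrite fmorphV rmorph_nat.
  rewrite /M /heinz -half ripZl ripDl /gen_aluthge /= subKr; congr (_ * (_ + _)).
    rewrite hnorm_sq SE; congr (rip _ _).
    rewrite [X in pow_op P X _ = _]E3 pow_opD//; congr (Q (pow_op P h (V k _))).
    by rewrite [in RHS]E1 (pow_opD pP x r0 d0 E1').
  rewrite -sQQ ripC; congr (rip _ _).
  rewrite SE [X in _ = pow_op P X _]E2 (pow_opD pP _ d0 r0 E2').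
  congr (Q (pow_op P (1 - t) (V k _))).
  by rewrite [X in pow_op P X _ = _]E4 (pow_opD pP (Q x) h0 d0 E4').
have h2 := sum_rip_le (fun k => M k (Q x)) (fun k => Q (S k x)).
rewrite key in h2.
have h4 : Num.sqrt (tsq M (Q x)) <= tuple_norm M * hnorm (Q x).
  by rewrite -[leRHS]ger0_norm ?mulr_ge0 ?hnorm_ge0// -sqrtr_sqr ler_wsqrtr// exprMn tsq_le.
have h5 := le_trans h2 (ler_wpM2r (sqrtr_ge0 _) h4).
rewrite -/b2 in h5; set b := Num.sqrt b2 in h5.
have bE : b ^+ 2 = b2 by rewrite sqr_sqrtr.
rewrite -(ler_pM2r q20).
(* completing the square bounds [2 |M| |Q x| b] by [b^2 + |M|^2 |Q x|^2] *)
have := sqr_ge0 (b - tuple_norm M * hnorm (Q x)).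
rewrite -bE in h5; move: hx h5.
set q := hnorm (Q x); set m := tuple_norm M; set r := rip _ _.
move=> *; nra.
Qed.

Lemma gen_aluthge_interpolation t : 0 <= t <= 1 ->
  tuple_norm (gen_aluthge P V t) <=
  tuple_norm (duggal P V) `^ t * tuple_norm (fun k => V k \o P) `^ (1 - t).
Proof.
move=> t01.
have -> : duggal P V = gen_aluthge P V 1.
  apply/funext => k; apply/funext => x.
  by rewrite /duggal /gen_aluthge /= subrr pow_op0// pow_op1.
have -> : (fun k => V k \o P) = gen_aluthge P V 0.
  apply/funext => k; apply/funext => x.
  by rewrite /gen_aluthge /= subr0 pow_op0// pow_op1.
have [L L0 hL] := sandwich_bound.
pose phi s := tuple_norm (gen_aluthge P V s).
rewrite -/(phi t) -/(phi 1) -/(phi 0).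
apply: (@midpoint_interpolation R phi L _ _ t t01).
  move=> s s01; rewrite (tuple_norm_ge0 (gen_aluthge_bounded s01)) /=.
  have s01' : 0 <= 1 - s <= 1 by move/andP: s01 => [? ?]; apply/andP; split; lra.
  by apply: tuple_norm_le => // x; exact: hL s (1 - s) s01 s01' x.
by move=> a b; exact: gen_aluthge_midpoint.
Qed.

End Polar.

(** [V*V] is an orthogonal projection [E], and [|V x|^2 = <E x, x> = |E x|^2]. *)
Lemma spherical_polar_contractive T V P : spherical_polar T V P ->
  forall x, tsq V x <= hnorm x ^+ 2.
Proof.
move=> [_ bV _ proj] x; rewrite -rip_gram_sq//.
have [h1 h2] := proj x; set E := gram V x in h1 h2 *.
have h3 : rip E (x - E) = 0 by rewrite /rip h2.
have -> : rip E x = hnorm E ^+ 2.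
  by move: h3; rewrite ripBr -hnorm_sq => /subr0_eq.
rewrite -[in leRHS](subrK E x); set w := x - E in h3 *; clearbody w.
rewrite [leRHS]hnorm_sq ripDl !ripDr h3 (ripC _ E) h3.
by rewrite -!hnorm_sq addr0 add0r lerDr sqr_ge0.
Qed.

Lemma duggal_le T V P : (forall k, bounded_operator (T k)) -> spherical_polar T V P ->
  tuple_norm (duggal P V) <= tuple_norm T.
Proof.
move=> bT TVP; have hV := spherical_polar_contractive TVP.
have [PE bV _ _] := TVP; have pG := gram_positive bT.
have [_ sP _] := sqrt_op_positive pG.
apply: tuple_norm_le => [|x]; first exact: tuple_norm_ge0.
have Pb y : hnorm (P y) ^+ 2 <= tuple_norm T ^+ 2 * hnorm y ^+ 2.
  rewrite hnorm_sq PE /tuple_abs -sP sqrt_op_sq// rip_gram_sq//.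
  exact: tsq_le.
rewrite (@le_trans _ _ (tuple_norm T ^+ 2 * tsq V x))//; last by rewrite ler_wpM2l ?sqr_ge0.
by rewrite /tsq mulr_sumr; apply: ler_sum => k _; exact: Pb.
Qed.
End Main.

Theorem theorem2p2 (R : realType) (H : hilbertType R)
    (sepH : separable_space H) (d : nat) (d_gt0 : (0 < d)%N)
    (T V : 'I_d -> H -> H) (P : H -> H)
    (bT : forall k, bounded_operator (T k))
    (TVP : spherical_polar T V P)
    (t : R) (t01 : 0 <= t <= 1) :
  [/\ tuple_norm (aluthge P V) <= tuple_norm (heinz P V t),
      tuple_norm (heinz P V t) <=
        2^-1 * (tuple_norm (duggal P V) `^ t * tuple_norm T `^ (1 - t) +
                tuple_norm (duggal P V) `^ (1 - t) * tuple_norm T `^ t) &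
      2^-1 * (tuple_norm (duggal P V) `^ t * tuple_norm T `^ (1 - t) +
              tuple_norm (duggal P V) `^ (1 - t) * tuple_norm T `^ t) <=
        tuple_norm T] /\
  [/\ tuple_norm (aluthge P V) <= tuple_norm (heinz P V t),
      tuple_norm (heinz P V t) <=
        2^-1 * (tuple_norm (duggal P V) + tuple_norm T) &
      2^-1 * (tuple_norm (duggal P V) + tuple_norm T) <= tuple_norm T].
Proof.
have [PE bV TE _] := TVP.
have pP : positive_op P by rewrite PE; exact/sqrt_op_positive/gram_positive.
have t01' : 0 <= 1 - t <= 1 by move/andP: t01 => [? ?]; apply/andP; split; lra.
have TVE : T = (fun k => V k \o P) by apply/funext.
have DT := duggal_le bT TVP.
have D0 : 0 <= tuple_norm (duggal P V).
  by apply: tuple_norm_ge0 => k; apply: bounded_operator_comp => //; case: pP.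
have h1 := aluthge_le_heinz pP bV t01.
have h2 : tuple_norm (heinz P V t) <=
        2^-1 * (tuple_norm (duggal P V) `^ t * tuple_norm T `^ (1 - t) +
                tuple_norm (duggal P V) `^ (1 - t) * tuple_norm T `^ t).
  apply: (le_trans (tuple_norm_mean (gen_aluthge_bounded pP bV t01) (gen_aluthge_bounded pP bV t01'))).
  rewrite ler_wpM2l ?invr_ge0// TVE lerD ?gen_aluthge_interpolation//.
  by have := gen_aluthge_interpolation pP bV t01'; rewrite subKr.
have h3 := heinz_mean_le D0 DT t01.
have h4 : 2^-1 * (tuple_norm (duggal P V) + tuple_norm T) <= tuple_norm T.
  by rewrite ler_pdivrMl// mulr_natl mulr2n lerD2r.
have h5 : 2^-1 * (tuple_norm (duggal P V) `^ t * tuple_norm T `^ (1 - t) +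
                tuple_norm (duggal P V) `^ (1 - t) * tuple_norm T `^ t) <=
   2^-1 * (tuple_norm (duggal P V) + tuple_norm T) by rewrite ler_wpM2l ?invr_ge0.
by split; split=> //; [exact: le_trans h4 | exact: le_trans h5].
Qed.
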